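(* Let $\mathbf{x}_i(k)$, $i\in\mathcal{V}$, $k\ge 0$, be generated by the quantized distributed subgradient algorithm described in the context, where the weight matrix $\mathbf{A}$ satisfies the weight assumption stated there. Let $\{\alpha(k)\}$ and $\{\beta(k)\}$ be two sequences of nonnegative and nonincreasing stepsizes with $\beta(k)>0$ for all $k$ and $\beta(0)<1$, satisfying $$\sum_{k=0}^{\infty}\alpha(k)=\sum_{k=0}^{\infty}\beta(k)=\infty,\quad \sum_{k=0}^{\infty}\frac{\alpha^2(k)}{\beta(k)}<\infty,\quad \sum_{k=0}^{\infty}\alpha^2(k)<\infty,\quad \sum_{k=0}^{\infty}\beta^2(k)<\infty$$ (for example $\alpha(k)=\frac{1}{k+2}$ and $\beta(k)=\frac{1}{(k+2)^s}$ with $s\in(\frac12,1)$). Then there is a (random) vector $\widetilde{\mathbf{x}}$ that is almost surely a solution of the problem $\min_{\mathbf{x}\in\mathcal{X}}\sum_{i=1}^n f_i(\mathbf{x})$ such that $$\lim_{k\to\infty}\mathbf{x}_i(k)=\widetilde{\mathbf{x}}\quad\text{almost surely, for all } i\in\mathcal{V}.$$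
   Context: **Problem.** $\mathcal{V}=\{1,\dots,n\}$ is a set of nodes, $\mathcal{X}=[\ell^1,u^1]\times\cdots\times[\ell^d,u^d]\subset\mathbb{R}^d$ is a compact box, and for each $i\in\mathcal{V}$, $f_i:\mathcal{X}\to\mathbb{R}$ is convex (possibly nonsmooth) and $L_i$-Lipschitz on $\mathcal{X}$ for some $L_i\ge 0$. The problem is to minimize $f(\mathbf{x})=\sum_{i=1}^n f_i(\mathbf{x})$ over $\mathbf{x}\in\mathcal{X}$. For $\mathbf{x}\in\mathcal{X}$, $\mathbf{g}_i(\mathbf{x})$ denotes a selected subgradient of $f_i$ at $\mathbf{x}$, i.e. $f_i(\mathbf{y})\ge f_i(\mathbf{x})+\mathbf{g}_i(\mathbf{x})^T(\mathbf{y}-\mathbf{x})$ for all $\mathbf{y}\in\mathcal{X}$, with $\|\mathbf{g}_i(\mathbf{x})\|\le L_i$ (subgradients are bounded by the Lipschitz constants). **Network and weight assumption.** $\mathcal{G}=(\mathcal{V},\mathcal{E})$, $\mathcal{E}\subset\mathcal{V}\times\mathcal{V}$, is a connected undirected graph; $\mathcal{N}_i=\{j:(i,j)\in\mathcal{E}\}$. The matrix $\mathbf{A}=[a_{ij}]\in\mathbb{R}^{n\times n}$ has $a_{ij}>0$ if $(i,j)\in\mathcal{E}$ and $a_{ij}=0$ otherwise, is doubly stochastic ($\sum_i a_{ij}=\sum_j a_{ij}=1$), irreducible and aperiodic. Its largest singular value is $1$, all the others are strictly less than $1$, and $\sigma_2\in(0,1)$ denotes the second largest. **Random quantization.** For each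 coordinate $m\in\{1,\dots,d\}$, $[\ell^m,u^m]$ carries a uniform grid $\ell^m=\tau_1<\tau_2<\cdots<\tau_B=u^m$ with spacing $\Delta^m=(u^m-\ell^m)/(B-1)$. For scalar $x\in[\tau_i,\tau_{i+1})$, with $p=(x-\tau_i)/\Delta^m$, the random quantization $\mathcal{Q}(x)$ equals $\tau_i$ with probability $1-p$ and $\tau_{i+1}$ with probability $p$ (and $\mathcal{Q}(\tau_i)=\tau_i$ for every grid point). For $\mathbf{x}\in\mathcal{X}$, $\mathcal{Q}(\mathbf{x})$ is obtained by quantizing each coordinate this way. **Algorithm.** Each node $i$ starts from an arbitrary $\mathbf{x}_i(0)\in\mathcal{X}$ and for $k\ge 0$ sets $$\mathbf{x}_i(k+1)=\mathcal{P}_{\mathcal{X}}\Big[(1-\beta(k))\mathbf{x}_i(k)+\beta(k)\sum_{j\in\mathcal{N}_i}a_{ij}\mathbf{q}_j(k)-\alpha(k)\mathbf{g}_i(\mathbf{x}_i(k))\Big],$$ where $\mathcal{P}_{\mathcal{X}}$ is Euclidean projection onto $\mathcal{X}$ and $\mathbf{q}_j(k)=\mathcal{Q}(\mathbf{x}_j(k))$, the quantization randomness at time $k$ being drawn afresh, so that, conditionally on the history of the algorithm up to and including $\mathbf{x}_1(k),\dots,\mathbf{x}_n(k)$, each coordinate of $\mathbf{q}_j(k)$ has the law prescribed above. *)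

(* Defs.v *)
From HB Require Import structures.
From mathcomp Require Export all_boot all_order all_algebra.
From mathcomp Require Export all_classical all_reals all_analysis.
Export Order.TTheory GRing.Theory Num.Theory.
Export numFieldNormedType.Exports.

#[export] Set Implicit Arguments.
#[export] Unset Strict Implicit.
#[export] Unset Printing Implicit Defensive.

Local Open Scope classical_set_scope.
Local Open Scope ring_scope.

Definition dotp (R : realType) (d : nat) (u v : 'rV[R]_d) : R :=
  \sum_(m < d) u 0 m * v 0 m.

(* The library norm `|u| on matrices is the sup norm, hence this definition. *)
Definition enorm (R : realType) (d : nat) (u : 'rV[R]_d) : R :=
  Num.sqrt (dotp u u).

Definition box (R : realType) (d : nat) (lo hi : 'rV[R]_d) : set 'rV[R]_d :=
  [set x | forall m, lo 0 m <= x 0 m <= hi 0 m].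

Definition elipschitz_on (R : realType) (d : nat) (X : set 'rV[R]_d) (L : R)
    (f : 'rV[R]_d -> R) : Prop :=
  forall x y, X x -> X y -> `|f x - f y| <= L * enorm (x - y).

Definition is_subgradient (R : realType) (d : nat) (X : set 'rV[R]_d)
    (f : 'rV[R]_d -> R) (x g : 'rV[R]_d) : Prop :=
  forall y, X y -> f x + dotp g (y - x) <= f y.

Definition is_proj (R : realType) (d : nat) (X : set 'rV[R]_d)
    (y p : 'rV[R]_d) : Prop :=
  X p /\ forall z, X z -> enorm (y - p) <= enorm (y - z).

Definition is_minimizer (R : realType) (d : nat) (X : set 'rV[R]_d)
    (f : 'rV[R]_d -> R) (x : 'rV[R]_d) : Prop :=
  X x /\ forall y, X y -> f x <= f y.

(* Self-loops are allowed; they are where the diagonal weights live. *)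
Definition connected_undirected (n : nat) (E : rel 'I_n) : Prop :=
  symmetric E /\ forall i j, connect E i j.

Definition doubly_stochastic (R : realType) (n : nat) (A : 'M[R]_n) : Prop :=
  (forall i, \sum_j A i j = 1) /\ (forall j, \sum_i A i j = 1).

Definition irreducible_mx (R : realType) (n : nat) (A : 'M[R]_n) : Prop :=
  forall i j, exists k : nat, 0 < (A ^+ k) i j.

(* For every i, the gcd of the return times {k >= 1 | (A ^+ k) i i > 0} is 1. *)
Definition aperiodic_mx (R : realType) (n : nat) (A : 'M[R]_n) : Prop :=
  forall (i : 'I_n) (p : nat),
    (forall k : nat, (0 < k)%N -> 0 < (A ^+ k) i i -> (p %| k)%N) -> p = 1%N.

Definition weight_assumption (R : realType) (n : nat) (E : rel 'I_n)
    (A : 'M[R]_n) : Prop :=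
  [/\ forall i j, (E i j -> 0 < A i j) /\ (~~ E i j -> A i j = 0),
      doubly_stochastic A, irreducible_mx A & aperiodic_mx A].

Definition grid_step (R : realType) (lo hi : R) (B : nat) : R :=
  (hi - lo) / B.-1%:R.

(* Grid points are numbered from 0: grid_pt lo hi B 0 = lo and, for 1 < B,
   grid_pt lo hi B B.-1 = hi. *)
Definition grid_pt (R : realType) (lo hi : R) (B t : nat) : R :=
  lo + t%:R * grid_step lo hi B.

(* Probability that the random quantization of x in [lo, hi] falls in S.  The
   sum has exactly one term when lo <= x < hi (the cell [tau_t, tau_(t+1))
   containing x) and none when x = hi. *)
Definition quant_law (R : realType) (lo hi : R) (B : nat) (x : R)
    (S : set R) : R :=
  let tau := grid_pt lo hi B in
  \sum_(t < B.-1 | tau t <= x < tau t.+1)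
    (let p := (x - tau t) / grid_step lo hi B in
     (1 - p) * \1_S (tau t) + p * \1_S (tau t.+1))
  + (if x == hi then \1_S hi else 0).

Definition rand_vec (R : realType) (disp : measure_display)
    (T : measurableType disp) (d : nat) (X : T -> 'rV[R]_d) : Prop :=
  forall m, measurable_fun setT (fun w => X w 0 m).

(* sigma-algebra of x(0), ..., x(k) and q(0), ..., q(k-1), over all nodes. *)
Definition history (R : realType) (T : Type) (n d : nat)
    (x q : nat -> 'I_n -> T -> 'rV[R]_d) (k : nat) : set (set T) :=
  <<s [set A | exists s i m (S : set R), measurable S /\
        (((s <= k)%N /\ A = [set w | S (x s i w 0 m)]) \/
         ((s < k)%N /\ A = [set w | S (q s i w 0 m)]))] >>.

(* Y is a version of the conditional probability P(E | F). *)
Definition is_cond_prob (R : realType) (disp : measure_display)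
    (T : measurableType disp) (P : probability T R) (F : set (set T))
    (E : set T) (Y : T -> R) : Prop :=
  [/\ forall S : set R, measurable S -> F (Y @^-1` S),
      P.-integrable setT (EFin \o Y) &
      forall A, F A -> (\int[P]_(w in A) (Y w)%:E = P (A `&` E))%E].

(* Only the conditional marginal laws of the coordinates are prescribed: no
   independence between the coordinates or the nodes is imposed. *)
Definition random_quantization (R : realType) (disp : measure_display)
    (T : measurableType disp) (P : probability T R) (n d : nat)
    (lo hi : 'rV[R]_d) (B : nat)
    (x q : nat -> 'I_n -> T -> 'rV[R]_d) : Prop :=
  forall (k : nat) (j : 'I_n) (m : 'I_d) (S : set R), measurable S ->
    is_cond_prob P (history x q k) [set w | S (q k j w 0 m)]
      (fun w => quant_law (lo 0 m) (hi 0 m) B (x k j w 0 m) S).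

Definition subgradient_step (R : realType) (T : Type) (n d : nat)
    (X : set 'rV[R]_d) (E : rel 'I_n) (A : 'M[R]_n)
    (g : 'I_n -> 'rV[R]_d -> 'rV[R]_d) (alpha beta : nat -> R)
    (x q : nat -> 'I_n -> T -> 'rV[R]_d) : Prop :=
  forall (k : nat) (i : 'I_n) (w : T),
    is_proj X
      ((1 - beta k) *: x k i w
       + beta k *: (\sum_(j < n | E i j) A i j *: q k j w)
       - alpha k *: g i (x k i w))
      (x k.+1 i w).

Definition stepsizes (R : realType) (alpha beta : nat -> R) : Prop :=
  [/\ (forall k, 0 <= alpha k) /\ nonincreasing_seq alpha,
      (forall k, 0 < beta k) /\ nonincreasing_seq beta,
      beta 0%N < 1,
      (\sum_(0 <= k <oo) (alpha k)%:E = +oo)%E /\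
      (\sum_(0 <= k <oo) (beta k)%:E = +oo)%E &
      [/\ (\sum_(0 <= k <oo) (alpha k ^+ 2 / beta k)%:E < +oo)%E,
          (\sum_(0 <= k <oo) (alpha k ^+ 2)%:E < +oo)%E &
          (\sum_(0 <= k <oo) (beta k ^+ 2)%:E < +oo)%E]].

(* Main.v *)
(* Fix a node r and write W(c) = sum_i |x_i - c|^2 for a minimizer c.  The
   averaging map (1 - beta) I + beta A decreases W(c) by beta (1 - beta) times
   the Dirichlet form of A, which dominates V = sum_i |x_i - x_r|^2 by a Poincare
   inequality along the paths of the connected graph.  Since the projection onto
   a box acts coordinatewise and does not increase distances to c, one step gives
     W+(c) <= W(c) - kappa beta V - 2 alpha (f(x_r) - f(c)) + 2 beta N(c)
              + K (alpha^2 + beta^2 + alpha^2 / beta),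
   where the quantization noise N(c) is an affine function of c whose coefficients
   are martingale differences.  The martingale series sum beta N(c) therefore
   converges, almost surely for all c simultaneously, and the rest is pathwise:
   W(c) converges, and sum beta V and sum alpha (f(x_r) - f(c)) are finite, hence
   so is sum alpha V.  As sum alpha is infinite, V + f(x_r) - f(c) is small along
   a subsequence; a cluster point of x_r along it is a minimizer c for which the
   convergent sequence W(c) has limit 0. *)

Require Import Defs.
From mathcomp Require Import all_boot all_order all_algebra.
From mathcomp Require Import all_classical all_reals all_analysis.
From mathcomp Require Import measurable_realfun ring lra.
Import Order.TTheory GRing.Theory Num.Theory.
Import numFieldNormedType.Exports.

Local Open Scope classical_set_scope.
Local Open Scope ring_scope.

(** * Real series *)

(** Subtracting from [w] the partial sums of [e] leaves a nonincreasing sequence bounded below,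
    whose total decrease bounds the partial sums of [h]. The errors may have any sign and only their
    series must converge, which is what martingale noise provides. *)
Lemma almost_supermartingale_cvg (R : realType) (w h e : R^nat) :
  (forall k, 0 <= w k) -> (forall k, 0 <= h k) -> cvgn (series e) ->
  (forall k, w k.+1 <= w k - h k + e k) ->
  cvgn w /\ cvgn (series h).
Proof.
move=> w0 h0 ce wS.
pose t := w - series e.
have tS k : t k.+1 + h k <= t k.
  rewrite /t /= !fctE seriesSr; have := wS k; lra.
have [M [Mreal HM]] := cvg_seq_bounded ce.
have eM k : series e k <= M + 1.
  apply: le_trans (ler_norm _) _; apply: (HM (M + 1)) => //; by rewrite ltrDl.
have tM k : - (M + 1) <= t k.
  by rewrite /t !fctE; have := eM k; have := w0 k; lra.
have ct : cvgn t.
  apply: nonincreasing_is_cvgn.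
    apply/nonincreasing_seqP => k; have := tS k; have := h0 k; lra.
  by exists (- (M + 1)) => _ [k _ <-].
split.
  have -> : w = t + series e by rewrite /t subrK.
  exact: is_cvgD.
have hst k : series h k <= t 0%N - t k.
  elim: k => [|k IH]; first by rewrite /series /= big_geq // subrr.
  by rewrite seriesSr; have := tS k; lra.
apply: nondecreasing_is_cvgn.
  by apply/nondecreasing_seqP => k; rewrite seriesSr lerDl.
exists (t 0%N + (M + 1)) => _ [k _ <-].
by apply: le_trans (hst k) _; have := tM k; lra.
Qed.

Lemma summable_EFin (R : realType) (u : R^nat) :
  (forall k, 0 <= u k) -> (\sum_(0 <= k <oo) (u k)%:E < +oo)%E ->
  cvgn (series u).
Proof. by move=> u0 /nnseries_is_cvg; apply. Qed.

Lemma cvg_series_EFin_lty (R : realType) (u : R^nat) :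
  (forall k, 0 <= u k) -> cvgn (series u) ->
  (\sum_(0 <= k <oo) (u k)%:E < +oo)%E.
Proof.
move=> u0 cu.
have -> : (\sum_(0 <= k <oo) (u k)%:E)%E = (limn (series u))%:E.
  rewrite -EFin_lim //; congr (limn _); apply/funext => k /=.
  by rewrite /series /= sumEFin.
exact: ltry.
Qed.

(** If [h] stayed above [eps] from [N] on, [a] would be dominated there by [eps^-1 * (a * h)] and
    its series would converge. *)
Lemma frequently_small_of_summable (R : realType) (a h : R^nat) :
  (forall k, 0 <= a k) -> (\sum_(0 <= k <oo) (a k)%:E = +oo)%E ->
  cvgn (series (fun k => a k * h k)) ->
  forall eps N, 0 < eps -> exists2 k, (N <= k)%N & h k < eps.
Proof.
move=> a0 ay ch eps N eps0; apply: contrapT => nex.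
have hge k : (N <= k)%N -> eps <= h k.
  by move=> Nk; rewrite leNgt; apply/negP => ?; apply: nex; exists k.
suff : cvgn (series a) by move/(cvg_series_EFin_lty a0); rewrite ay ltxx.
(* The sign of [h] before [N] is unknown, so only tails are compared; they are rewritten as full
   series whose first [N] terms vanish. *)
rewrite -(is_cvg_series_restrict N).
have: cvgn (series (eps^-1 *: (fun k => a k * h k))) by exact: is_cvg_seriesZ.
rewrite -(is_cvg_series_restrict N).
pose ind (k : nat) : R := (N <= k)%:R.
have sumE (u : R^nat) : [sequence \sum_(N <= k < n) u k]_n =
    series (fun k => (N <= k)%:R * u k).
  apply/funext => k; rewrite /series /=.
  rewrite (big_nat_widenl N 0) // big_mkcond /=; apply: eq_bigr => i _.
  by case: leqP; rewrite ?mul1r ?mul0r.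
rewrite !sumE => c; apply: series_le_cvg c => [k|k|k].
- by apply: mulr_ge0.
- case: (leqP N k) => Nk; rewrite ?mul0r // mul1r !fctE.
  rewrite /GRing.scale /=; apply: mulr_ge0; first by rewrite invr_ge0 ltW.
  by apply: mulr_ge0 => //; rewrite (le_trans _ (hge _ Nk)) // ltW.
- case: (leqP N k) => Nk; rewrite ?mul0r // !mul1r !fctE.
  rewrite /GRing.scale /= mulrCA -{1}[a k]mulr1 ler_wpM2l //.
  by rewrite ler_pdivlMl // mulr1 hge.
Qed.

(** * One step of the algorithm *)

(** Testing minimality at the endpoint next to [y], or at [y] itself when it lies in the interval,
    identifies [p] as [y] clamped to the interval. *)
Lemma sqr_proj_itv_le (R : realType) (a b y p t : R) :
  a <= p <= b -> a <= t <= b ->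
  (forall s, a <= s <= b -> (y - p) ^+ 2 <= (y - s) ^+ 2) ->
  (p - t) ^+ 2 <= (y - t) ^+ 2.
Proof.
move=> /andP[ap pb] /andP[at_ tb] H.
have ab : a <= b by lra.
case: (ltP y a) => [ya|ay].
  have := H a; rewrite lexx ab => /(_ isT) h.
  nra.
case: (ltP b y) => [yb|yb].
  have := H b; rewrite lexx ab => /(_ isT) h.
  nra.
have := H y; rewrite ay yb => /(_ isT); rewrite subrr expr0n /= => h.
have : (y - p) ^+ 2 = 0 by apply/eqP; rewrite eq_le h sqr_ge0.
by move=> /eqP; rewrite sqrf_eq0 subr_eq0 => /eqP ->.
Qed.

Lemma dotp_ge0 (R : realType) (d : nat) (u : 'rV[R]_d) : 0 <= dotp u u.
Proof. by apply: sumr_ge0 => m _; rewrite -expr2 sqr_ge0. Qed.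

Lemma enorm_sqr (R : realType) (d : nat) (u : 'rV[R]_d) :
  enorm u ^+ 2 = dotp u u.
Proof. by rewrite sqr_sqrtr // dotp_ge0. Qed.

Lemma dotpE (R : realType) (d : nat) (u : 'rV[R]_d) :
  dotp u u = \sum_m u 0 m ^+ 2.
Proof. by apply: eq_bigr => m _; rewrite expr2. Qed.

(** The squared distance is a sum over coordinates and the box is a product, so altering coordinate
    [m] of [p] alone is an admissible competitor and reduces the claim to an interval. *)
Lemma proj_box_coord (R : realType) (d : nat) (lo hi y p : 'rV[R]_d) :
  is_proj (box lo hi) y p -> forall m t, lo 0 m <= t <= hi 0 m ->
  (p 0 m - t) ^+ 2 <= (y 0 m - t) ^+ 2.
Proof.
move=> [pX pmin] m t tX; apply: sqr_proj_itv_le (pX m) tX _ => s sX.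
pose z : 'rV[R]_d := \row_l (if l == m then s else p 0 l).
have zX : box lo hi z by move=> l; rewrite mxE; case: eqP => [->|].
have := pmin z zX; rewrite /enorm ler_sqrt ?dotp_ge0 // !dotpE.
rewrite (bigD1 m) //= [X in _ <= X](bigD1 m) //= !mxE eqxx.
rewrite (eq_bigr (fun l => (y - z) 0 l ^+ 2)) ?lerD2r //.
by move=> l /negbTE lm; rewrite !mxE lm.
Qed.

(* One coordinate of the update: [x + b * s] is the averaging part, [n] the
   quantization noise and [g] the subgradient. *)
Lemma perturbed_step_le (R : realType) (p c x s n g a b : R) :
  (p - c) ^+ 2 <= (x + b * s + b * n - a * g - c) ^+ 2 ->
  (p - c) ^+ 2 <= (x + b * s - c) ^+ 2 + 2 * b * ((x - c) * n)
    + 2 * a * (g * (c - x)) + (b ^+ 2 * (s ^+ 2 + 4 * n ^+ 2) + 4 * a ^+ 2 * g ^+ 2).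
Proof.
move=> /le_trans; apply; rewrite -subr_ge0.
have -> : (x + b * s - c) ^+ 2 + 2 * b * ((x - c) * n)
    + 2 * a * (g * (c - x)) + (b ^+ 2 * (s ^+ 2 + 4 * n ^+ 2) + 4 * a ^+ 2 * g ^+ 2)
   - (x + b * s + b * n - a * g - c) ^+ 2 =
   (b * s - (b * n - a * g)) ^+ 2 + 2 * (b * n + a * g) ^+ 2 by ring.
by apply: addr_ge0; [exact: sqr_ge0|apply: mulr_ge0 => //; exact: sqr_ge0].
Qed.

(** The difference of the two sides is the variance of [u] under the weights [p]. *)
Lemma sqr_weighted_mean_le (R : realType) (n : nat) (p u : 'I_n -> R) :
  (forall j, 0 <= p j) -> \sum_j p j = 1 ->
  (\sum_j p j * u j) ^+ 2 <= \sum_j p j * u j ^+ 2.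
Proof.
move=> p0 p1.
have varE w : \sum_j p j * (u j - w) ^+ 2 =
    \sum_j p j * u j ^+ 2 - 2 * w * \sum_j p j * u j + w ^+ 2 * \sum_j p j.
  rewrite !mulr_sumr -sumrB -big_split /=; apply: eq_bigr => j _; ring.
set w := \sum_j p j * u j.
have : 0 <= \sum_j p j * (u j - w) ^+ 2.
  by apply: sumr_ge0 => j _; rewrite mulr_ge0 ?sqr_ge0.
rewrite varE p1 -/w; lra.
Qed.

Definition dirichlet (R : realType) (n : nat) (A : 'M[R]_n) (u : 'I_n -> R) : R :=
  \sum_i \sum_j A i j * (u i - u j) ^+ 2.

Lemma dirichlet_ge (R : realType) (n : nat) (A : 'M[R]_n) (u : 'I_n -> R) :
  (forall i j, 0 <= A i j) -> forall i j, A i j * (u i - u j) ^+ 2 <= dirichlet A u.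
Proof.
move=> A0 i j; rewrite /dirichlet (bigD1 i) //= (bigD1 j) //= -addrA lerDl.
rewrite addr_ge0 //; apply: sumr_ge0 => k _; first by rewrite mulr_ge0 ?sqr_ge0.
by apply: sumr_ge0 => l _; rewrite mulr_ge0 ?sqr_ge0.
Qed.

(** After expanding the square, row sums collapse the [u i ^+ 2] terms and column sums the
    [u j ^+ 2] terms, so no symmetry of [A] is involved. *)
Lemma dirichletE (R : realType) (n : nat) (A : 'M[R]_n) (u : 'I_n -> R) :
  doubly_stochastic A ->
  dirichlet A u = 2 * \sum_i u i ^+ 2 - 2 * \sum_i u i * \sum_j A i j * u j.
Proof.
move=> [Ar Ac].
have rowE : \sum_i \sum_j A i j * u i ^+ 2 = \sum_i u i ^+ 2.
  by apply: eq_bigr => i _; rewrite -mulr_suml Ar mul1r.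
have colE : \sum_i \sum_j A i j * u j ^+ 2 = \sum_i u i ^+ 2.
  by rewrite exchange_big /=; apply: eq_bigr => j _; rewrite -mulr_suml Ac mul1r.
have -> : 2 * \sum_i u i ^+ 2 = \sum_i \sum_j A i j * u i ^+ 2
    + \sum_i \sum_j A i j * u j ^+ 2 by rewrite rowE colE; ring.
rewrite mulr_sumr -big_split -sumrB /=; apply: eq_bigr => i _.
by rewrite !mulr_sumr -big_split -sumrB /=; apply: eq_bigr => j _; ring.
Qed.

(** Expanding the square leaves a cross term, which [dirichletE] expresses through the Dirichlet
    form, and the squared norm of [A u], which Jensen on rows and then column sums bound by that of
    [u]. *)
Lemma lazy_average_contraction (R : realType) (n : nat) (A : 'M[R]_n) (b : R)
    (u : 'I_n -> R) :
  (forall i j, 0 <= A i j) -> doubly_stochastic A ->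
  \sum_i ((1 - b) * u i + b * \sum_j A i j * u j) ^+ 2 <=
  \sum_i u i ^+ 2 - b * (1 - b) * dirichlet A u.
Proof.
move=> A0 Ads; have [Ar Ac] := Ads.
have W2 : \sum_i (\sum_j A i j * u j) ^+ 2 <= \sum_i u i ^+ 2.
  apply: (@le_trans _ _ (\sum_i \sum_j A i j * u j ^+ 2)).
    by apply: ler_sum => i _; apply: sqr_weighted_mean_le.
  by rewrite exchange_big /=; apply: ler_sum => j _; rewrite -mulr_suml Ac mul1r.
rewrite dirichletE //.
have -> : \sum_i ((1 - b) * u i + b * \sum_j A i j * u j) ^+ 2 =
   (1 - b) ^+ 2 * \sum_i u i ^+ 2
   + 2 * b * (1 - b) * \sum_i (u i * \sum_j A i j * u j)
   + b ^+ 2 * \sum_i (\sum_j A i j * u j) ^+ 2.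
  rewrite !mulr_sumr -!big_split /=; apply: eq_bigr => i _; ring.
have := ler_wpM2l (sqr_ge0 b) W2; lra.
Qed.

(** Induction along a path: each edge splits the difference in two, at the cost of a factor 2, and
    the edge increment is a single term of the Dirichlet form. The constant depends on the path but
    not on [u]. *)
Lemma poincare_path (R : realType) (n : nat) (E : rel 'I_n) (A : 'M[R]_n) r i :
  (forall i j, 0 <= A i j) -> (forall i j, E i j -> 0 < A i j) -> connect E r i ->
  exists2 C, 0 <= C & forall u : 'I_n -> R, (u i - u r) ^+ 2 <= C * dirichlet A u.
Proof.
move=> A0 EA /connectP[p pth ->]; elim: p r pth => [|j p IH] r /=.
  by move=> _; exists 0 => // u; rewrite subrr expr0n mul0r.
move=> /andP[/EA Arj] /IH[C C0 HC].
exists (2 * C + 2 * (A r j)^-1) => [|u].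
  by rewrite addr_ge0 ?mulr_ge0 ?invr_ge0 // ltW.
set ui := u _.
have h1 : (ui - u j) ^+ 2 <= C * dirichlet A u by exact: HC.
have h2 : (u r - u j) ^+ 2 <= (A r j)^-1 * dirichlet A u.
  by rewrite ler_pdivlMl //; apply: dirichlet_ge.
apply: (@le_trans _ _ (2 * (ui - u j) ^+ 2 + 2 * (u r - u j) ^+ 2)).
  by rewrite -subr_ge0 (_ : _ - _ = (ui + u r - 2 * u j) ^+ 2) ?sqr_ge0 //; ring.
lra.
Qed.

Lemma poincare (R : realType) (n : nat) (E : rel 'I_n) (A : 'M[R]_n) r :
  (forall i j, 0 <= A i j) -> (forall i j, E i j -> 0 < A i j) ->
  (forall i, connect E r i) ->
  exists2 C, 0 < C &
    forall u : 'I_n -> R, \sum_i (u i - u r) ^+ 2 <= C * dirichlet A u.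
Proof.
move=> A0 EA conn.
have /choice[C HC] i : exists C, 0 <= C /\
    forall u : 'I_n -> R, (u i - u r) ^+ 2 <= C * dirichlet A u.
  by have [C ? ?] := poincare_path A0 EA (conn i); exists C.
(* The summand 1 makes the constant strictly positive, so that the decrease rate of the descent
   inequality may divide by it. *)
exists (1 + \sum_i C i) => [|u].
  by rewrite ltr_pwDl // sumr_ge0 // => i _; case: (HC i).
have D0 : 0 <= dirichlet A u.
  by apply: sumr_ge0 => i _; apply: sumr_ge0 => j _; rewrite mulr_ge0 ?sqr_ge0.
rewrite mulrDl mul1r mulr_suml -[X in X <= _]add0r lerD //.
by apply: ler_sum => i _; case: (HC i).
Qed.

(** This is W(c) of the overview; at [c = x r] it becomes the disagreement V. *)
Definition sqdist (R : realType) (n d : nat) (x : 'I_n -> 'rV[R]_d)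
    (c : 'rV[R]_d) : R := \sum_i \sum_m (x i 0 m - c 0 m) ^+ 2.

(** This is N(c) of the overview: the quantization errors mixed by [A], paired with the displacement
    from [c]. *)
Definition noise (R : realType) (n d : nat) (A : 'M[R]_n)
    (x q : 'I_n -> 'rV[R]_d) (c : 'rV[R]_d) : R :=
  \sum_i \sum_m (x i 0 m - c 0 m) * \sum_j A i j * (q j 0 m - x j 0 m).

Lemma weighted_sum_bound (R : realType) (n : nat) (p u : 'I_n -> R) (H : R) :
  (forall j, 0 <= p j) -> \sum_j p j = 1 -> (forall j, `|u j| <= H) ->
  (\sum_j p j * u j) ^+ 2 <= H ^+ 2.
Proof.
move=> p0 p1 uH; apply: le_trans (sqr_weighted_mean_le _ p0 p1) _.
rewrite -[H ^+ 2]mul1r -p1 mulr_suml; apply: ler_sum => j _.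
have := uH j; rewrite ler_norml => /andP[? ?]; rewrite ler_wpM2l //; nra.
Qed.

Lemma sum_const2 (R : realType) (n d : nat) (t : R) :
  \sum_(i < n) \sum_(m < d) t = n%:R * (d%:R * t).
Proof.
under eq_bigr do rewrite sumr_const card_ord.
by rewrite sumr_const card_ord !mulr_natl.
Qed.

(** The coordinatewise bounds of [perturbed_step_le] are summed, the averaging part is contracted by
    the Poincare inequality, and the cost of evaluating all [f i] at the common point [x r] is
    absorbed in half of that contraction. The constants are fixed before the iterates, the stepsizes
    and [c]. *)
Lemma step_descent (R : realType) (n d : nat) (lo hi : 'rV[R]_d)
    (f : 'I_n -> 'rV[R]_d -> R) (L : 'I_n -> R)
    (g : 'I_n -> 'rV[R]_d -> 'rV[R]_d) (E : rel 'I_n) (A : 'M[R]_n) (b0 : R)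
    (r : 'I_n) :
  (forall i, 0 <= L i) ->
  (forall i, elipschitz_on (box lo hi) (L i) (f i)) ->
  (forall i y, box lo hi y ->
     is_subgradient (box lo hi) (f i) y (g i y) /\ enorm (g i y) <= L i) ->
  connected_undirected E -> weight_assumption E A -> b0 < 1 ->
  exists kap K : R, [/\ 0 < kap, 0 <= K &
    forall (a b : R) (x q x' : 'I_n -> 'rV[R]_d) (c : 'rV[R]_d),
      0 <= a -> 0 < b <= b0 -> box lo hi c ->
      (forall i, box lo hi (x i)) -> (forall i, box lo hi (q i)) ->
      (forall i, is_proj (box lo hi)
        ((1 - b) *: x i + b *: (\sum_(j < n | E i j) A i j *: q j)
         - a *: g i (x i)) (x' i)) ->
      sqdist x' c <= sqdist x c - kap * (b * sqdist x (x r))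
        + 2 * a * (\sum_i f i c - \sum_i f i (x r))
        + 2 * b * noise A x q c
        + K * (a ^+ 2 + b ^+ 2 + a ^+ 2 / b)].
Proof.
move=> hL hlip hsub [_ conn] [AE Ads _ _] b01.
have A0 i j : 0 <= A i j.
  by case: (boolP (E i j)) => h; [rewrite ltW // (AE i j).1|rewrite (AE i j).2].
have [Ar Ac] := Ads.
have [C C0 HC] := poincare A0 (fun i j => (AE i j).1) (conn r).
(* The averaging yields a decrease at rate [2 * kap]; one half survives and the other pays for the
   gradient cross terms in [gr]. *)
pose kap := (1 - b0) / (2 * C).
have kap0 : 0 < kap by rewrite divr_gt0 ?subr_gt0 ?mulr_gt0.
pose H := \sum_m `|hi 0 m - lo 0 m|.
have bH m s t : lo 0 m <= s <= hi 0 m -> lo 0 m <= t <= hi 0 m -> `|s - t| <= H.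
  move=> /andP[? ?] /andP[? ?].
  apply: (@le_trans _ _ `|hi 0 m - lo 0 m|).
    by rewrite [leRHS]ger0_norm ?ler_norml; lra.
  by rewrite /H (bigD1 m) //= lerDl sumr_ge0.
have H0 : 0 <= H by rewrite sumr_ge0.
pose L2 := \sum_i L i ^+ 2.
have L20 : 0 <= L2 by apply: sumr_ge0 => i _; rewrite sqr_ge0.
pose K := n%:R * (d%:R * (5 * H ^+ 2)) + 4 * L2 + L2 / kap.
have T10 : 0 <= n%:R * (d%:R * (5 * H ^+ 2)).
  by rewrite !mulr_ge0 ?sqr_ge0.
have T30 : 0 <= L2 / kap by rewrite divr_ge0 // ltW.
exists kap, K; split => //; first by rewrite !addr_ge0 // mulr_ge0.
move=> a b x q x' c a0 /andP[bgt0 bb0] cX xX qX px.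
(* [s] is the drift of one averaging step and [eta] the mixed quantization error, so the point being
   projected is [x + b * s + b * eta - a * G] in coordinates. *)
pose s i m := \sum_j A i j * (x j 0 m - x i 0 m).
pose eta i m := \sum_j A i j * (q j 0 m - x j 0 m).
pose G i := g i (x i).
have sE i m : s i m = \sum_j A i j * x j 0 m - x i 0 m.
  rewrite /s; under eq_bigr do rewrite mulrBr.
  by rewrite sumrB -mulr_suml Ar mul1r.
have etaE i m : eta i m = \sum_j A i j * q j 0 m - \sum_j A i j * x j 0 m.
  by rewrite /eta -sumrB; apply: eq_bigr => j _; rewrite mulrBr.
have step i m : (x' i 0 m - c 0 m) ^+ 2 <=
    (x i 0 m + b * s i m - c 0 m) ^+ 2
    + 2 * b * ((x i 0 m - c 0 m) * eta i m)
    + 2 * a * (G i 0 m * (c 0 m - x i 0 m))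
    + (b ^+ 2 * (s i m ^+ 2 + 4 * eta i m ^+ 2) + 4 * a ^+ 2 * G i 0 m ^+ 2).
  apply: perturbed_step_le; have := proj_box_coord (px i) (cX m).
  congr (_ <= (_ - _) ^+ 2).
  rewrite !mxE summxE /G; congr (_ - _).
  (* Weights vanish off the edges, so the sum over neighbours is a full row sum. *)
  have -> : \sum_(j < n | E i j) (A i j *: q j) 0 m = \sum_j A i j * q j 0 m.
    rewrite big_mkcond /=; apply: eq_bigr => j _; rewrite !mxE.
    by case: ifPn => // /(AE i j).2 ->; rewrite mul0r.
  rewrite sE etaE; ring.
have tot : sqdist x' c <= \sum_m \sum_i (x i 0 m + b * s i m - c 0 m) ^+ 2
    + 2 * b * noise A x q c + 2 * a * \sum_i dotp (G i) (c - x i)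
    + \sum_i \sum_m (b ^+ 2 * (s i m ^+ 2 + 4 * eta i m ^+ 2))
    + 4 * a ^+ 2 * \sum_i dotp (G i) (G i).
  rewrite exchange_big /= /noise /dotp !mulr_sumr -!big_split /=.
  apply: ler_sum => i _; rewrite !mulr_sumr -!big_split /=.
  apply: ler_sum => m _; rewrite !mxE -!expr2.
  by apply: le_trans (step i m) _; rewrite addrA lexx.
apply: le_trans tot _.
have avg : \sum_m \sum_i (x i 0 m + b * s i m - c 0 m) ^+ 2 <=
    sqdist x c - 2 * kap * (b * sqdist x (x r)).
  have sx : sqdist x (x r) <= C * \sum_m dirichlet A (fun i => x i 0 m).
    rewrite /sqdist exchange_big /= mulr_sumr; apply: ler_sum => m _.
    exact: (HC (fun i => x i 0 m)).
  have av m : \sum_i (x i 0 m + b * s i m - c 0 m) ^+ 2 <=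
      \sum_i (x i 0 m - c 0 m) ^+ 2 - b * (1 - b) * dirichlet A (fun i => x i 0 m).
    have := @lazy_average_contraction _ _ _ b (fun i => x i 0 m - c 0 m) A0 Ads.
    have -> : dirichlet A (fun i => x i 0 m - c 0 m) = dirichlet A (fun i => x i 0 m).
      by apply: eq_bigr => i _; apply: eq_bigr => j _; congr (_ * _ ^+ 2); ring.
    congr (_ <= _); apply: eq_bigr => i _; congr (_ ^+ 2).
    have -> : \sum_j A i j * (x j 0 m - c 0 m) = \sum_j A i j * x j 0 m - c 0 m.
      under eq_bigr do rewrite mulrBr.
      by rewrite sumrB -mulr_suml Ar mul1r.
    rewrite sE; ring.
  set D := \sum_m dirichlet _ _ in sx.
  have D0 : 0 <= D.
    by rewrite -(pmulr_rge0 _ C0) (le_trans _ sx) // sumr_ge0 // => i _;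
      apply: sumr_ge0 => m _; rewrite sqr_ge0.
  have h1 : \sum_m \sum_i (x i 0 m + b * s i m - c 0 m) ^+ 2 <=
      sqdist x c - b * (1 - b) * D.
    rewrite /sqdist /D [X in _ <= X - _]exchange_big /= mulr_sumr -sumrB.
    by apply: ler_sum => m _; exact: av.
  apply: le_trans h1 _; rewrite lerD2l lerN2.
  have -> : 2 * kap * (b * sqdist x (x r)) = b * (1 - b0) * (sqdist x (x r) / C).
    by rewrite /kap; field; rewrite gt_eqF.
  have sxC : sqdist x (x r) / C <= D by rewrite ler_pdivrMr // mulrC.
  apply: (@le_trans _ _ (b * (1 - b0) * D)).
    by rewrite ler_wpM2l // mulr_ge0 ?subr_ge0 // ltW.
  by rewrite ler_wpM2r // ler_wpM2l ?lerD2l ?lerN2 // ltW.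
(* The subgradient inequality gives [f i c - f i (x i)]; moving to [x r] costs [L i] times the
   distance [N], and weighted AM-GM splits [a * L i * N] into a part of [kap * b * N ^+ 2] and the
   [a ^+ 2 / b] error. *)
have gr : 2 * a * \sum_i dotp (G i) (c - x i) <=
    2 * a * (\sum_i f i c - \sum_i f i (x r))
    + kap * (b * sqdist x (x r)) + L2 / kap * (a ^+ 2 / b).
  have -> : L2 / kap * (a ^+ 2 / b) = \sum_i L i ^+ 2 / kap * (a ^+ 2 / b).
    by rewrite /L2 !mulr_suml.
  rewrite /sqdist -sumrB !mulr_sumr -!big_split /=; apply: ler_sum => i _.
  have [sg _] := hsub i _ (xX i).
  have h1 := sg _ cX.
  have := hlip i _ _ (xX i) (xX r); rewrite ler_norml => /andP[h2 _].
  have -> : \sum_m (x i 0 m - x r 0 m) ^+ 2 = enorm (x i - x r) ^+ 2.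
    by rewrite enorm_sqr dotpE; apply: eq_bigr => m _; rewrite !mxE.
  set N := enorm _ in h2 *.
  have kb : 0 < kap * b by rewrite mulr_gt0.
  have amgm : 2 * a * (L i * N) <= kap * (b * N ^+ 2) + L i ^+ 2 / kap * (a ^+ 2 / b).
    rewrite -subr_ge0.
    have -> : kap * (b * N ^+ 2) + L i ^+ 2 / kap * (a ^+ 2 / b) - 2 * a * (L i * N)
      = (kap * b * N - a * L i) ^+ 2 / (kap * b).
      by field; rewrite !gt_eqF.
    by rewrite divr_ge0 ?sqr_ge0 // ltW.
  have h3 : dotp (G i) (c - x i) <= f i c - f i (x r) + L i * N.
    by rewrite /G; lra.
  have := ler_wpM2l (mulr_ge0 (ler0n R 2) a0) h3; rewrite mulrDr; lra.
(* The factor 5 is 1 + 4: both [s] and [eta] are weighted means of coordinate differences within the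
   box, hence bounded by [H]. *)
have e1 : \sum_i \sum_m (b ^+ 2 * (s i m ^+ 2 + 4 * eta i m ^+ 2)) <=
    n%:R * (d%:R * (5 * H ^+ 2)) * b ^+ 2.
  rewrite mulrC [leRHS]mulrCA [X in _ <= _ * X]mulrCA -sum_const2.
  apply: ler_sum => i _; apply: ler_sum => m _.
  rewrite ler_wpM2l ?sqr_ge0 //.
  have h1 : s i m ^+ 2 <= H ^+ 2.
    by apply: weighted_sum_bound => // j; apply: bH; [exact: xX|exact: xX].
  have h2 : eta i m ^+ 2 <= H ^+ 2.
    by apply: weighted_sum_bound => // j; apply: bH; [exact: qX|exact: xX].
  lra.
have e2 : 4 * a ^+ 2 * \sum_i dotp (G i) (G i) <= 4 * L2 * a ^+ 2.
  rewrite [leRHS]mulrAC ler_wpM2l ?mulr_ge0 ?sqr_ge0 //.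
  apply: ler_sum => i _; rewrite -enorm_sqr ler_pXn2r ?nnegrE ?sqrtr_ge0 //.
  by have [] := hsub i _ (xX i).
have ab0 : 0 <= a ^+ 2 / b by rewrite divr_ge0 ?sqr_ge0 // ltW.
have a20 := sqr_ge0 a; have b20 := sqr_ge0 b.
have eK : n%:R * (d%:R * (5 * H ^+ 2)) * b ^+ 2 + 4 * L2 * a ^+ 2
    + L2 / kap * (a ^+ 2 / b) <= K * (a ^+ 2 + b ^+ 2 + a ^+ 2 / b).
  have L40 : 0 <= 4 * L2 by rewrite mulr_ge0.
  rewrite /K -subr_ge0.
  set t1 := n%:R * _ in T10 *; set t3 := L2 / kap in T30 *; set t2 := 4 * L2 in L40 *.
  set u := a ^+ 2 / b in ab0 *; set u1 := a ^+ 2 in a20 *; set u2 := b ^+ 2 in b20 *.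
  have -> : (t1 + t2 + t3) * (u1 + u2 + u) - (t1 * u2 + t2 * u1 + t3 * u) =
    t1 * u1 + t1 * u + (t2 * u2 + t2 * u) + (t3 * u1 + t3 * u2) by ring.
  by rewrite !addr_ge0 // mulr_ge0.
lra.
Qed.

(** * Pathwise convergence *)

Lemma box_compact (R : realType) (d : nat) (lo hi : 'rV[R]_d) :
  compact (box lo hi).
Proof.
have -> : box lo hi = [set v : 'rV[R]_d | forall m, `[lo 0 m, hi 0 m]%classic (v 0 m)].
  by apply/seteqP; split => v H m; have := H m; rewrite /= in_itv.
apply: (@rV_compact R d (fun m => `[lo 0 m, hi 0 m]%classic)) => m.
exact: segment_compact.
Qed.

Lemma box_cluster (R : realType) (d : nat) (lo hi : 'rV[R]_d) (u : nat -> 'rV[R]_d) :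
  (forall k, box lo hi (u k)) ->
  exists2 c, box lo hi c & forall eps N, 0 < eps ->
    exists2 k, (N <= k)%N & forall m, `|u k 0 m - c 0 m| < eps.
Proof.
move=> uX.
have uB : (u @ \oo) (box lo hi) by exists 0%N => // k _; exact: uX.
have [c [cX cc]] := @box_compact _ _ lo hi (u @ \oo) _ uB.
exists c => // eps N eps0.
have uN : (u @ \oo) [set u k | k in [set k | (N <= k)%N]].
  by exists N => // k Nk; exists k.
have [_ [[k Nk <-] [_ ck]]] := cc _ _ uN (nbhsx_ballx c eps eps0).
by exists k => // m; rewrite distrC; exact: ck.
Qed.

Lemma enorm_le_sum (R : realType) (d : nat) (u : 'rV[R]_d) :
  enorm u <= \sum_m `|u 0 m|.
Proof.
rewrite -(ler_pXn2r (n := 2)) ?nnegrE ?sqrtr_ge0 ?sumr_ge0 // enorm_sqr dotpE.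
rewrite [leRHS]expr2 mulr_suml; apply: ler_sum => m _.
rewrite -real_normK ?num_real // expr2 ler_wpM2l //.
by rewrite (bigD1 m) //= lerDl sumr_ge0.
Qed.

(** Compactness plus Lipschitz continuity. It serves twice: on a minimizing sequence, to produce a
    minimizer, and on a subsequence of the iterates of one node. *)
Lemma box_cluster_sublevel (R : realType) (d : nat) (lo hi : 'rV[R]_d)
    (F : 'rV[R]_d -> R) (L v : R) (u : nat -> 'rV[R]_d) :
  0 <= L -> elipschitz_on (box lo hi) L F ->
  (forall k, box lo hi (u k)) -> (forall k, F (u k) <= v + k.+1%:R^-1) ->
  exists c, [/\ box lo hi c, F c <= v & forall eps N, 0 < eps ->
    exists2 k, (N <= k)%N & forall m, `|u k 0 m - c 0 m| < eps].
Proof.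
move=> L0 FL uX uF; have [c cX cc] := box_cluster uX.
exists c; split => //; apply/ler_addgt0Pr => e e0.
(* [L * d] is a Lipschitz constant for the sup norm; adding 1 keeps the divisor positive. *)
pose Ld := L * d%:R + 1.
have Ld0 : 0 < Ld by rewrite ltr_wpDl // mulr_ge0.
have [N _ HN] : \forall k \near \oo, k.+1%:R^-1 < e / 2.
  apply: (@cvgr_lt _ _ \oo _ (fun k => k.+1%:R^-1 : R) 0).
    exact: cvg_harmonic.
  by rewrite divr_gt0.
have [k Nk uk] := cc (e / 2 / Ld) N (divr_gt0 (divr_gt0 e0 (ltr0n _ 2)) Ld0).
have := FL _ _ (uX k) cX; rewrite ler_norml => /andP[h1 _].
have h2 : L * enorm (u k - c) <= e / 2.
  apply: (@le_trans _ _ (L * (d%:R * (e / 2 / Ld)))).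
    rewrite ler_wpM2l // (le_trans (enorm_le_sum _)) //.
    rewrite mulr_natl -[X in _ *+ X]card_ord -sumr_const.
    by apply: ler_sum => m _; rewrite !mxE ltW.
  rewrite [leLHS](_ : _ = (L * d%:R) / Ld * (e / 2)); last by ring.
  rewrite -[leRHS]mul1r ler_wpM2r ?divr_ge0 ?(ltW e0) //.
  by rewrite ler_pdivrMr // mul1r lerDl.
have h3 : F (u k) < v + e / 2.
  by apply: le_lt_trans (uF k) _; rewrite ltrD2l; exact: HN.
move: h1 h2 h3; set t := L * _; lra.
Qed.

Lemma ex_minimizer (R : realType) (d : nat) (lo hi : 'rV[R]_d)
    (F : 'rV[R]_d -> R) (L : R) :
  0 <= L -> elipschitz_on (box lo hi) L F -> box lo hi !=set0 ->
  exists c, is_minimizer (box lo hi) F c.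
Proof.
move=> L0 FL [x0 x0X].
pose S := F @` box lo hi.
have Sinf : has_inf S.
  split; first by exists (F x0); exists x0.
  exists (F x0 - L * \sum_m `|hi 0 m - lo 0 m|) => _ [y yX <-].
  have := FL _ _ x0X yX; rewrite ler_norml => /andP[_ h].
  have : L * enorm (x0 - y) <= L * \sum_m `|hi 0 m - lo 0 m|.
    rewrite ler_wpM2l // (le_trans (enorm_le_sum _)) //; apply: ler_sum => m _.
    have := x0X m; have := yX m; rewrite !mxE => /andP[? ?] /andP[? ?].
    by rewrite [leRHS]ger0_norm ?ler_norml; lra.
  lra.
have /choice[u Hu] (k : nat) : exists y, box lo hi y /\ F y <= inf S + k.+1%:R^-1.
  have [|_ [y yX <-] Fy] := @inf_adherent _ S k.+1%:R^-1 _ Sinf.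
    by rewrite invr_gt0.
  by exists y; split => //; exact: ltW.
have [c [cX Fc _]] :=
  box_cluster_sublevel L0 FL (fun k => (Hu k).1) (fun k => (Hu k).2).
exists c; split => // y yX; apply: le_trans Fc _.
by apply: ge_inf; [exact: Sinf.2|exists y].
Qed.

Lemma elipschitz_on_sum (R : realType) (n d : nat) (X : set 'rV[R]_d)
    (f : 'I_n -> 'rV[R]_d -> R) (L : 'I_n -> R) :
  (forall i, elipschitz_on X (L i) (f i)) ->
  elipschitz_on X (\sum_i L i) (fun y => \sum_i f i y).
Proof.
move=> fL x y xX yX; rewrite -sumrB mulr_suml.
by apply: le_trans (ler_norm_sum _ _ _) _; apply: ler_sum => i _; exact: fL.
Qed.

Lemma cvg_rowP (R : realType) (d : nat) (u : nat -> 'rV[R]_d) (c : 'rV[R]_d) :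
  (forall m, u k 0 m @[k --> \oo] --> c 0 m) -> u k @[k --> \oo] --> c.
Proof.
move=> uc; apply/cvg_ballP => e e0.
have : \forall k \near \oo, forall m : 'I_d, ball (c 0 m) e (u k 0 m).
  apply: filter_forall => m; have /cvg_ballP := uc m; exact.
by apply: filterS => k H; split => // i m; rewrite ord1.
Qed.

Lemma sqdist_ge0 (R : realType) (n d : nat) (x : 'I_n -> 'rV[R]_d)
    (c : 'rV[R]_d) :
  0 <= sqdist x c.
Proof. by apply: sumr_ge0 => i _; apply: sumr_ge0 => m _; rewrite sqr_ge0. Qed.

Lemma sqdist_ge (R : realType) (n d : nat) (x : 'I_n -> 'rV[R]_d)
    (c : 'rV[R]_d) i m :
  (x i 0 m - c 0 m) ^+ 2 <= sqdist x c.
Proof.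
rewrite /sqdist (bigD1 i) //= (bigD1 m) //= -addrA lerDl addr_ge0 //.
  by apply: sumr_ge0 => l _; rewrite sqr_ge0.
by apply: sumr_ge0 => j _; apply: sumr_ge0 => l _; rewrite sqr_ge0.
Qed.

(** Passing through [x r] with [(s + t)^2 <= 2 s^2 + 2 t^2]: when the nodes nearly agree and one of
    them is near [c], all of them are. *)
Lemma sqdist_shift (R : realType) (n d : nat) (x : 'I_n -> 'rV[R]_d)
    (c : 'rV[R]_d) r (e : R) :
  0 <= e -> (forall m, `|x r 0 m - c 0 m| < e) ->
  sqdist x c <= 2 * sqdist x (x r) + 2 * (n%:R * (d%:R * e ^+ 2)).
Proof.
move=> e0 xe.
rewrite -(sum_const2 n d) /sqdist !mulr_sumr -[leRHS]big_split; apply: ler_sum => i _ /=.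
rewrite !mulr_sumr -[leRHS]big_split; apply: ler_sum => m _ /=.
have := ltW (xe m); rewrite ler_norml => /andP[h1 h2].
have h3 : (x r 0 m - c 0 m) ^+ 2 <= e ^+ 2 by nra.
have := sqr_ge0 (x i 0 m - 2 * x r 0 m + c 0 m); nra.
Qed.

(** No probability remains here. The noise series is assumed to converge for every [c] because the
    minimizer to which it is finally applied depends on the path. *)
Lemma pathwise_convergence (R : realType) (n d : nat) (lo hi : 'rV[R]_d)
    (f : 'I_n -> 'rV[R]_d -> R) (L : 'I_n -> R)
    (g : 'I_n -> 'rV[R]_d -> 'rV[R]_d) (E : rel 'I_n) (A : 'M[R]_n)
    (alpha beta : nat -> R) (x q : nat -> 'I_n -> 'rV[R]_d) :
  (forall m, lo 0 m < hi 0 m) ->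
  (forall i, 0 <= L i) ->
  (forall i, elipschitz_on (box lo hi) (L i) (f i)) ->
  (forall i y, box lo hi y ->
     is_subgradient (box lo hi) (f i) y (g i y) /\ enorm (g i y) <= L i) ->
  connected_undirected E -> weight_assumption E A -> stepsizes alpha beta ->
  (forall k i, box lo hi (x k i)) -> (forall k i, box lo hi (q k i)) ->
  (forall k i, is_proj (box lo hi)
     ((1 - beta k) *: x k i + beta k *: (\sum_(j < n | E i j) A i j *: q k j)
      - alpha k *: g i (x k i)) (x k.+1 i)) ->
  (forall c, cvgn (series (fun k => beta k * noise A (x k) (q k) c))) ->
  exists2 c, is_minimizer (box lo hi) (fun y => \sum_i f i y) c &
    forall i, x k i @[k --> \oo] --> c.
Proof.
move=> lohi hL hlip hsub hE hA [[a0 _] [b0 bdec] b01 [ay _] [ab2 a2 b2]] xX qX px cN.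
pose F y := \sum_i f i y.
have LF0 : 0 <= \sum_i L i by apply: sumr_ge0.
have FL := elipschitz_on_sum hlip.
have [c0 [c0X c0min]] : exists c, is_minimizer (box lo hi) F c.
  apply: ex_minimizer LF0 FL _; exists lo => m; by rewrite lexx ltW.
(* The argument fixes a reference node; without nodes the convergence is vacuous and [c0] serves. *)
case: n => [|n] in f L g E A x q hL hlip hsub hE hA xX qX px cN F LF0 FL c0min *.
  by exists c0 => // -[].
pose r : 'I_n.+1 := ord0.
have [kap [K [kap0 K0 descent]]] := step_descent r hL hlip hsub hE hA b01.
have bb0 k : 0 < beta k <= beta 0%N by rewrite b0 /=; apply: bdec.
pose s k := alpha k ^+ 2 + beta k ^+ 2 + alpha k ^+ 2 / beta k.
have cab : cvgn (series (fun k => alpha k ^+ 2 / beta k)).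
  by apply: summable_EFin => // k; rewrite divr_ge0 ?sqr_ge0 // ltW.
have cs : cvgn (series s).
  apply: is_cvg_seriesD => //; apply: is_cvg_seriesD.
    by apply: summable_EFin => // k; rewrite sqr_ge0.
  by apply: summable_EFin => // k; rewrite sqr_ge0.
pose V k := sqdist (x k) (x k r).
pose gap k := F (x k r) - F c0.
have gap0 k : 0 <= gap k by rewrite subr_ge0; exact: c0min.
pose h k := kap * (beta k * V k) + 2 * (alpha k * gap k).
have h0 k : 0 <= h k.
  have := ltW (b0 k) => ?.
  by rewrite addr_ge0 // !mulr_ge0 ?sqdist_ge0 // ltW.
(* All minimizers share the value [F c0], so the same [h] works for each of them. *)
have main c : is_minimizer (box lo hi) F c ->
    cvgn (fun k => sqdist (x k) c) /\ cvgn (series h).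
  move=> [cX cmin].
  apply: (@almost_supermartingale_cvg _ _ _
    (2 *: (fun k => beta k * noise A (x k) (q k) c) + K *: s)) => //.
  - by move=> k; exact: sqdist_ge0.
  - by apply: is_cvg_seriesD; exact: is_cvg_seriesZ.
  - move=> k; have := descent (alpha k) (beta k) (x k) (q k) (x k.+1) c (a0 k)
      (bb0 k) cX (xX k) (qX k) (px k).
    have Fc : F c = F c0 by apply/eqP; rewrite eq_le cmin // c0min.
    rewrite -/(F c) -/(F (x k r)) Fc -/(V k).
    move=> /le_trans; apply; rewrite /h /gap /s !fctE /GRing.scale /=.
    by rewrite le_eqVlt; apply/orP; left; apply/eqP; ring.
have ch := (main _ (conj c0X c0min)).2.
pose H := \sum_m (hi 0 m - lo 0 m) ^+ 2.
pose M := n.+1%:R * H.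
have VM k : V k <= M.
  rewrite /V /sqdist /M mulr_natl -[X in _ *+ X]card_ord -sumr_const.
  apply: ler_sum => i _; apply: ler_sum => m _.
  have := xX k i m; have := xX k r m => /andP[? ?] /andP[? ?]; nra.
(* [alpha * V] is at most [alpha ^+ 2 / beta + beta * V ^+ 2], and [V <= M] makes the last term at
   most [M * (beta * V)]. In [K2], the part [M / kap] covers this and the part 1 covers
   [alpha * gap]. *)
have cg : cvgn (series (fun k => alpha k * (V k + gap k))).
  pose K2 := M / kap + 1.
  have M0 : 0 <= M by rewrite mulr_ge0 // sumr_ge0 // => m _; rewrite sqr_ge0.
  apply: (@series_le_cvg _ _ ((fun k => alpha k ^+ 2 / beta k) + K2 *: h)).
  - by move=> k; rewrite mulr_ge0 // addr_ge0 // sqdist_ge0.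
  - move=> k; rewrite !fctE /GRing.scale /=; apply: addr_ge0.
      by rewrite divr_ge0 ?sqr_ge0 // ltW.
    by rewrite mulr_ge0 // addr_ge0 // divr_ge0 // ltW.
  - move=> k; rewrite !fctE /GRing.scale /=.
    have V0 : 0 <= V k by exact: sqdist_ge0.
    have bk := b0 k; have ag : 0 <= alpha k * gap k by rewrite mulr_ge0.
    have e1 : alpha k * V k <= alpha k ^+ 2 / beta k + beta k * V k ^+ 2.
      rewrite -subr_ge0 (_ : _ - _ = (alpha k / beta k - V k / 2) ^+ 2 * beta k
        + 3 / 4 * (beta k * V k ^+ 2)); last by field; rewrite gt_eqF.
      by rewrite addr_ge0 // mulr_ge0 ?sqr_ge0 ?(ltW bk) // mulr_ge0 ?sqr_ge0 // ltW.
    have e2 : beta k * V k ^+ 2 <= M * (beta k * V k).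
      rewrite [leRHS]mulrCA ler_wpM2l ?(ltW bk) // expr2 ler_wpM2r //; exact: VM.
    have e3 : K2 * h k = M * (beta k * V k) + kap * (beta k * V k)
        + 2 * (M / kap) * (alpha k * gap k) + 2 * (alpha k * gap k).
      by rewrite /K2 /h; field; rewrite gt_eqF.
    have e4 : 0 <= kap * (beta k * V k) by rewrite !mulr_ge0 // ltW.
    have e5 : 0 <= 2 * (M / kap) * (alpha k * gap k).
      by rewrite mulr_ge0 // mulr_ge0 // divr_ge0 // ltW.
    rewrite e3 mulrDr; lra.
  - by apply: is_cvg_seriesD => //; exact: is_cvg_seriesZ.
(* The indices [j k >= k] form the subsequence along which both the disagreement and the optimality
   gap vanish. *)
have /choice[j Hj] (k : nat) : exists l, (k <= l)%N /\ V l + gap l < k.+1%:R^-1.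
  have [l kl Vl] := @frequently_small_of_summable _ _ _ a0 ay cg
    (k.+1%:R^-1 : R) k (ltac:(by rewrite invr_gt0)).
  by exists l.
have [||c [cX Fc cc]] := @box_cluster_sublevel _ _ lo hi F _ (F c0)
    (fun k => x (j k) r) LF0 FL.
- by move=> k; exact: xX.
- move=> k /=; rewrite -lerBlDl -/(gap (j k)).
  apply: ltW; apply: le_lt_trans (Hj k).2; rewrite lerDr; exact: sqdist_ge0.
have cmin : is_minimizer (box lo hi) F c.
  by split => // y yX; apply: le_trans Fc _; exact: c0min.
have [cW _] := main c cmin.
exists c => //.
(* The limit [l] exists already. Were it positive, [V < l / 8] and closeness [e] with
   [n * d * e ^+ 2 <= l / 8] would force some late distance below [l / 2]. *)
have W0 : sqdist (x k) c @[k --> \oo] --> (0 : R).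
  set l := limn (fun k => sqdist (x k) c) in cW *.
  have l0 : 0 <= l by apply: limr_ge => //; apply: nearW => k; exact: sqdist_ge0.
  have cl : sqdist (x k) c @[k --> \oo] --> l by exact: cW.
  suff l_le : l <= 0 by have <- : l = 0 by apply/eqP; rewrite eq_le l_le.
  rewrite leNgt; apply/negP => lpos.
  pose D : R := n.+1%:R * d%:R + 1.
  have D0 : 0 < D by rewrite ltr_wpDl // mulr_ge0.
  have [N1 _ HN1] : \forall k \near \oo, l / 2 < sqdist (x k) c.
    by apply: cvgr_gt cl _ _; lra.
  have [N2 _ HN2] : \forall k \near \oo, k.+1%:R^-1 < l / 8.
    apply: (@cvgr_lt _ _ \oo _ (fun k => k.+1%:R^-1 : R) 0).
      exact: cvg_harmonic.
    by rewrite divr_gt0.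
  pose e := Num.sqrt (l / 8 / D).
  have le0 : 0 < l / 8 / D by rewrite !divr_gt0.
  have e0 : 0 < e by rewrite sqrtr_gt0.
  have [k Nk xe] := cc e (maxn N1 N2) e0.
  have Vk : V (j k) < l / 8.
    apply: (@lt_trans _ _ k.+1%:R^-1).
      by apply: le_lt_trans (Hj k).2; rewrite lerDl.
    by apply: HN2; apply: leq_trans Nk; exact: leq_maxr.
  have := @sqdist_shift _ _ _ (x (j k)) c r e (ltW e0) xe.
  rewrite -/(V (j k)) sqr_sqrtr ?(ltW le0) //.
  have : l / 2 < sqdist (x (j k)) c.
    apply: HN1; rewrite /= (leq_trans _ (Hj k).1) //.
    by apply: leq_trans Nk; exact: leq_maxl.
  have : n.+1%:R * (d%:R * (l / 8 / D)) <= l / 8.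
    rewrite [leLHS](_ : _ = n.+1%:R * d%:R / D * (l / 8)); last by ring.
    rewrite -[leRHS]mul1r ler_wpM2r ?divr_ge0 //.
    by rewrite ler_pdivrMr // mul1r lerDl.
  lra.
move=> i; apply: cvg_rowP => m; apply/cvgrPdist_lt => e e0.
have : \forall k \near \oo, sqdist (x k) c < e ^+ 2.
  by apply: (@cvgr_lt _ _ \oo _ (fun k => sqdist (x k) c) 0) => //;
    exact: exprn_gt0.
apply: filterS => k Wk.
rewrite -(ltr_pXn2r (n := 2)) ?nnegrE ?(ltW e0) // real_normK ?num_real //.
rewrite -sqrrN opprB; apply: le_lt_trans Wk; exact: sqdist_ge.
Qed.

Lemma cvg_series_sum (R : realType) (I : finType) (u : I -> R^nat) :
  (forall i, cvgn (series (u i))) -> cvgn (series (fun k => \sum_i u i k)).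
Proof.
move=> cu.
have -> : (fun k => \sum_i u i k) = \sum_i u i.
  by apply/funext => k; rewrite fct_sumE.
elim/big_ind : _ => // [|v w cv cw]; last exact: is_cvg_seriesD.
have -> : series (0 : R^nat) = cst 0.
  by apply/funext => k; rewrite /series /= big1.
exact: is_cvg_cst.
Qed.

(** The noise is a finite combination of series that do not involve [c], with [c] only in the
    coefficients; hence one almost sure event handles all [c]. *)
Lemma cvg_noise (R : realType) (n d : nat) (A : 'M[R]_n) (beta : nat -> R)
    (x q : nat -> 'I_n -> 'rV[R]_d) :
  (forall j m, cvgn (series (fun k => beta k * (q k j 0 m - x k j 0 m)))) ->
  (forall i j m, cvgn (series (fun k =>
     beta k * x k i 0 m * (q k j 0 m - x k j 0 m)))) ->
  forall c, cvgn (series (fun k => beta k * noise A (x k) (q k) c)).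
Proof.
move=> c1 c2 c.
have -> : (fun k => beta k * noise A (x k) (q k) c) = (fun k =>
    \sum_(i < n) \sum_(m < d) \sum_(j < n)
      (A i j *: (fun k => beta k * x k i 0 m * (q k j 0 m - x k j 0 m))
       + (- (c 0 m * A i j)) *: (fun k => beta k * (q k j 0 m - x k j 0 m))) k).
  apply/funext => k; rewrite /noise !mulr_sumr; apply: eq_bigr => i _.
  rewrite !mulr_sumr; apply: eq_bigr => m _.
  rewrite !mulr_sumr; apply: eq_bigr => j _.
  rewrite !fctE /GRing.scale /=; ring.
apply: cvg_series_sum => i; apply: cvg_series_sum => m.
apply: cvg_series_sum => j; apply: is_cvg_seriesD; exact: is_cvg_seriesZ.
Qed.

(** * Martingale difference series *)

(** A class stable under sums and products and integrable for every probability, which discharges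
    all integrability conditions below. *)
Definition bmeas (disp : measure_display) (T : measurableType disp) (R : realType)
    (Z : T -> R) : Prop :=
  measurable_fun [set: T] Z /\ exists C, forall w, `|Z w| <= C.

Lemma bmeas_cst (disp : measure_display) (T : measurableType disp) (R : realType)
    (c : R) : bmeas (fun _ : T => c).
Proof. by split; [exact: measurable_cst|exists `|c|]. Qed.

Lemma bmeasD (disp : measure_display) (T : measurableType disp) (R : realType)
    (Y Z : T -> R) : bmeas Y -> bmeas Z -> bmeas (fun w => Y w + Z w).
Proof.
move=> [mY [C hC]] [mZ [K hK]]; split; first exact: measurable_funD.
by exists (C + K) => w; rewrite (le_trans (ler_normD _ _)) // lerD.
Qed.

Lemma bmeasM (disp : measure_display) (T : measurableType disp) (R : realType)
    (Y Z : T -> R) : bmeas Y -> bmeas Z -> bmeas (fun w => Y w * Z w).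
Proof.
move=> [mY [C hC]] [mZ [K hK]]; split; first exact: measurable_funM.
by exists (C * K) => w; rewrite normrM ler_pM.
Qed.

Lemma bmeasB (disp : measure_display) (T : measurableType disp) (R : realType)
    (Y Z : T -> R) : bmeas Y -> bmeas Z -> bmeas (fun w => Y w - Z w).
Proof.
move=> bY bZ.
have := bmeasD bY (bmeasM (bmeas_cst T (-1)) bZ).
by under eq_fun do rewrite mulN1r.
Qed.

Lemma bmeas_sum (disp : measure_display) (T : measurableType disp) (R : realType)
    (I : Type) (s : seq I) (Z : I -> T -> R) :
  (forall i, bmeas (Z i)) -> bmeas (fun w => \sum_(i <- s) Z i w).
Proof.
move=> bZ; elim: s => [|i s IH].
  by under eq_fun do rewrite big_nil; exact: bmeas_cst.
by under eq_fun do rewrite big_cons; exact: bmeasD.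
Qed.

Lemma bmeas_indic (disp : measure_display) (T : measurableType disp) (R : realType)
    (A : set T) : measurable A -> bmeas (\1_A : T -> R).
Proof.
move=> mA; split; first exact: measurable_indic.
by exists 1 => w; rewrite indicE ger0_norm // lern1 leq_b1.
Qed.

Lemma measurable_preimageT (disp : measure_display) (T : measurableType disp)
    (R : realType) (Z : T -> R) (S : set R) :
  measurable_fun [set: T] Z -> measurable S -> measurable (Z @^-1` S).
Proof. by move=> mZ mS; rewrite -[X in measurable X]setTI; exact: mZ. Qed.

Lemma bmeas_sub (disp1 disp2 : measure_display) (T1 : measurableType disp1)
    (T2 : measurableType disp2) (R : realType) (h : T2 -> T1) (Z : T1 -> R) :
  measurable_fun [set: T2] h -> bmeas Z -> bmeas (fun w => Z (h w)).
Proof.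
move=> mh [mZ [C hC]]; split; last by exists C.
exact: (measurableT_comp mZ mh).
Qed.

Lemma bmeas_integrable (disp : measure_display) (T : measurableType disp)
    (R : realType) (P : probability T R) (Z : T -> R) :
  bmeas Z -> P.-integrable setT (EFin \o Z).
Proof.
move=> [mZ [C hC]]; have PT : (P setT < +oo)%E by rewrite probability_setT ltry.
apply: (measurable_bounded_integrable measurableT PT mZ).
exists C; split; first exact: num_real.
by move=> M CM w _ /=; apply: le_trans (hC w) _; exact: ltW.
Qed.

Lemma Rintegral_sum (disp : measure_display) (T : measurableType disp)
    (R : realType) (P : probability T R) (I : Type) (s : seq I) (Z : I -> T -> R) :
  (forall i, bmeas (Z i)) ->
  \int[P]_w (\sum_(i <- s) Z i w) = \sum_(i <- s) \int[P]_w Z i w.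
Proof.
move=> bZ; elim: s => [|i s IH].
  under eq_Rintegral do rewrite big_nil.
  by rewrite Rintegral_cst // mul0r big_nil.
under eq_Rintegral do rewrite big_cons.
rewrite RintegralD //; last by apply: bmeas_integrable; exact: bmeas_sum.
  by rewrite IH big_cons.
by apply: bmeas_integrable.
Qed.

Lemma normr_Rintegral_le (disp : measure_display) (T : measurableType disp)
    (R : realType) (P : probability T R) (Z : T -> R) (C : R) :
  bmeas Z -> (forall w, `|Z w| <= C) -> `|\int[P]_w Z w| <= C.
Proof.
move=> bZ hC.
have cC c : \int[P]_w (cst c w) = c.
  rewrite Rintegral_cst // (_ : fine _ = 1) ?mulr1 //.
  by rewrite -[RHS]/(fine 1%E); congr fine; exact: probability_setT.
have bC c : bmeas (cst c : T -> R) by exact: bmeas_cst.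
rewrite ler_norml; apply/andP; split.
  rewrite -[leLHS]cC; apply: le_Rintegral => //; try exact: bmeas_integrable.
  by move=> w _ /=; have := hC w; rewrite ler_norml => /andP[].
rewrite -[leRHS]cC; apply: le_Rintegral => //; try exact: bmeas_integrable.
by move=> w _ /=; have := hC w; rewrite ler_norml => /andP[].
Qed.

(** The sum counts the integers from 1 to [M] not exceeding [y], so it is the floor of [y]. *)
Lemma unit_staircase_approx (R : realType) (M : nat) (y : R) :
  0 <= y <= M%:R -> `|y - \sum_(r < M) \1_[set z : R | r.+1%:R <= z] y| <= 1.
Proof.
elim: M => [|M IH] /andP[y0 yM].
  by rewrite big_ord0 subr0 ger0_norm // (le_trans yM).
have stepE r : (\1_[set z : R | r.+1%:R <= z] y : R) = ((r.+1%:R <= y)%R)%:R.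
  by rewrite indicE; congr ((nat_of_bool _)%:R); apply/idP/idP; rewrite inE.
rewrite big_ord_recr /= stepE; case: (leP y M%:R) => [yM'|My].
  rewrite (_ : (M.+1%:R <= y) = false) ?addr0; first by apply: IH; rewrite y0.
  by apply/negbTE; rewrite -ltNge (le_lt_trans yM') // ltr_nat.
rewrite (eq_bigr (fun=> 1)) => [|r _].
  rewrite sumr_const card_ord; case: (leP M.+1%:R y) => [yM'|My'].
    have -> : y = M.+1%:R by apply/eqP; rewrite eq_le yM.
    by rewrite -natr1 subrr normr0.
  rewrite addr0 ger0_norm ?subr_ge0 ?(ltW My) // lerBlDl.
  by rewrite natr1 ltW.
by rewrite stepE (le_trans _ (ltW My)) // ler_nat.
Qed.

(* Layer-cake approximation of [Z] by indicators of sets of the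
   sub-sigma-algebra. *)
Lemma orthogonal_of_indic (disp disp' : measure_display) (T : measurableType disp)
    (T' : measurableType disp') (R : realType) (P : probability T R)
    (h : T -> T') (D : T -> R) :
  measurable_fun [set: T] h -> bmeas D ->
  (forall A, measurable A -> \int[P]_w (\1_A (h w) * D w) = 0) ->
  forall Z : T' -> R, bmeas Z -> \int[P]_w (Z (h w) * D w) = 0.
Proof.
move=> mh bD D0 Z bZ; have [mZ [C0 hC0]] := bZ; have [_ [K hK]] := bD.
have hK0 : 0 <= K by apply: le_trans (normr_ge0 _) (hK point).
pose C := Num.bound C0.
have hC w : `|Z w| <= C%:R.
  apply: le_trans (hC0 w) _; apply/ltW/archi_boundP.
  exact: le_trans (normr_ge0 _) (hC0 w).
apply/eqP; rewrite -normr_le0; apply/ler_addgt0Pr => e e0; rewrite add0r.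
(* Layers of height [1 / N] leave an error [K / N] below [e]; the [M] layers exhaust the range of
   [Z + C]. *)
pose N := (Num.bound (K / e)).+1.
pose M := (N * C.*2)%N.
have N0 : 0 < N%:R :> R by rewrite ltr0n.
pose A r : set T' := (fun w => N%:R * (Z w + C%:R)) @^-1` [set z : R | r.+1%:R <= z].
have mA r : measurable (A r).
  apply: measurable_preimageT.
    exact: (bmeasM (bmeas_cst T' N%:R) (bmeasD bZ (bmeas_cst T' C%:R))).1.
  rewrite (_ : [set z | _] = `[r.+1%:R, +oo[%classic); first exact: measurable_itv.
  by apply/seteqP; split => z /=; rewrite in_itv /= andbT.
pose F w := \sum_(r < M) (\1_(A r) (h w) * D w).
have bF r : bmeas (fun w => \1_(A r) (h w) * D w).
  by apply: bmeasM => //; apply: (bmeas_sub mh); exact: bmeas_indic.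
have bZD : bmeas (fun w => Z (h w) * D w) by apply: bmeasM => //; exact: bmeas_sub.
have F0 : \int[P]_w F w = 0.
  by rewrite Rintegral_sum // big1 // => r _; exact: D0.
have D00 : \int[P]_w D w = 0.
  by rewrite -(D0 setT measurableT); apply: eq_Rintegral => w _; rewrite indicT mul1r.
(* [D] and [F] integrate to 0, so [W] has the integral of the product, while pointwise it is [D]
   times the error of the staircase. *)
pose W w := Z (h w) * D w + (C%:R * D w - N%:R^-1 * F w).
have bCD : bmeas (fun w => C%:R * D w) by apply: bmeasM => //; exact: bmeas_cst.
have bNF : bmeas (fun w => N%:R^-1 * F w).
  by apply: bmeasM; [exact: bmeas_cst|apply: bmeas_sum].
have bCN := bmeasB bCD bNF.
have bW : bmeas W by exact: bmeasD.
have WE : \int[P]_w W w = \int[P]_w (Z (h w) * D w).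
  have bF' : bmeas F by exact: bmeas_sum.
  rewrite /W RintegralD //; [|exact: bmeas_integrable|exact: bmeas_integrable].
  rewrite RintegralB //; [|exact: bmeas_integrable|exact: bmeas_integrable].
  rewrite RintegralZl //; last exact: bmeas_integrable.
  rewrite RintegralZl //; last exact: bmeas_integrable.
  by rewrite F0 D00 !mulr0 subrr addr0.
rewrite -WE; apply: (normr_Rintegral_le P bW) => w.
pose y := N%:R * (Z (h w) + C%:R).
have WyE : W w = N%:R^-1 * (y - \sum_(r < M) \1_[set z : R | r.+1%:R <= z] y) * D w.
  have FE : F w = (\sum_(r < M) \1_[set z : R | r.+1%:R <= z] y) * D w.
    by rewrite /F mulr_suml.
  by rewrite /W FE /y; field; rewrite gt_eqF.
have yM : 0 <= y <= M%:R.
  have := hC (h w); rewrite ler_norml => /andP[h1 h2].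
  rewrite /y mulr_ge0 ?(ltW N0) //=; last by lra.
  rewrite /M natrM ler_pM2l // -muln2 natrM; lra.
have := unit_staircase_approx yM => stair.
rewrite WyE normrM normrM ger0_norm ?invr_ge0 ?(ltW N0) //.
apply: (@le_trans _ _ (N%:R^-1 * 1 * K)).
  by rewrite ler_pM // ?mulr_ge0 ?invr_ge0 ?(ltW N0) // ler_wpM2l ?invr_ge0 ?(ltW N0).
rewrite mulr1 ler_pdivrMl // -ler_pdivrMr // ltW //.
rewrite (lt_trans (archi_boundP _)) ?divr_ge0 ?(ltW e0) // ltr_nat ltnSn //.
Qed.

(* The partial sums of [D m, D m.+1, ...], frozen once their absolute value
   reaches [eps]: its square integral controls the running maximum. *)
Fixpoint stopped_sum (T : Type) (R : realType) (D : nat -> T -> R) (eps : R)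
    (m k : nat) (w : T) : R :=
  if k is k'.+1 then
    let s := stopped_sum D eps m k' w in
    s + \1_[set z | `|z| < eps] s * D (m + k')%N w
  else 0.

(** A stopped sum that reaches [eps] stays there, so a small final value means that freezing never
    occurred. *)
Lemma stopped_sum_small (T : Type) (R : realType) (D : nat -> T -> R) (eps : R)
    (m K : nat) (w : T) :
  `|stopped_sum D eps m K w| < eps ->
  stopped_sum D eps m K w = \sum_(i < K) D (m + i)%N w /\
  forall k, (k <= K)%N -> `|\sum_(i < k) D (m + i)%N w| < eps.
Proof.
elim: K => [|K IH] /=.
  rewrite big_ord0 => h; split => // k; rewrite leqn0 => /eqP ->.
  by rewrite big_ord0.
set s := stopped_sum D eps m K w in IH *.
have [sS|sB] := ltP `|s| eps.
  have -> : \1_[set z : R | `|z| < eps] s = 1 :> R by rewrite indicE mem_set.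
  rewrite mul1r => h; have [sE H] := IH sS.
  split; first by rewrite big_ord_recr /= sE.
  move=> k; rewrite leq_eqVlt => /predU1P[->|]; last by rewrite ltnS; exact: H.
  by rewrite big_ord_recr /= -sE.
have -> : \1_[set z : R | `|z| < eps] s = 0 :> R.
  by rewrite indicE memNset //= => h; move: sB; rewrite leNgt h.
by rewrite mul0r addr0 ltNge sB.
Qed.

(** Retyping the sample space with the sub-sigma-algebra makes every closure lemma on [bmeas]
    available for it. *)
Definition adapted (disp : measure_display) (T : measurableType disp) (R : realType)
    (G : set (set T)) (Z : T -> R) : Prop :=
  @bmeas _ (g_sigma_algebraType G) R Z.

Lemma measurable_id_sub (disp : measure_display) (T : measurableType disp)
    (G : set (set T)) : <<s G >> `<=` measurable ->
  measurable_fun [set: T] (id : T -> g_sigma_algebraType G).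
Proof. by move=> GT _ A GA; rewrite setTI; exact: GT. Qed.

Lemma adapted_bmeas (disp : measure_display) (T : measurableType disp) (R : realType)
    (G : set (set T)) (Z : T -> R) :
  <<s G >> `<=` measurable -> adapted G Z -> bmeas Z.
Proof. by move=> /measurable_id_sub h; exact: (bmeas_sub h). Qed.

Lemma adapted_sub (disp : measure_display) (T : measurableType disp) (R : realType)
    (G1 G2 : set (set T)) (Z : T -> R) :
  <<s G1 >> `<=` <<s G2 >> -> adapted G1 Z -> adapted G2 Z.
Proof.
move=> G12; apply: (@bmeas_sub _ _ (g_sigma_algebraType G1)
  (g_sigma_algebraType G2) R id).
by move=> _ A GA; rewrite setTI; exact: G12.
Qed.

Lemma indic_ball_bmeas (disp : measure_display) (T : measurableType disp)
    (R : realType) (Z : T -> R) (eps : R) :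
  bmeas Z -> bmeas (fun w => \1_[set z | `|z| < eps] (Z w) : R).
Proof.
move=> [mZ _]; apply: (bmeas_sub mZ); apply: bmeas_indic.
rewrite -[X in measurable X]setTI.
rewrite (_ : [set z | _] = Num.norm @^-1` `]-oo, eps[%classic); last first.
  by apply/seteqP; split => z /=; rewrite in_itv.
by apply: normr_measurable; [exact: measurableT|exact: measurable_itv].
Qed.

Lemma stopped_sum_adapted (disp : measure_display) (T : measurableType disp)
    (R : realType) (G : nat -> set (set T)) (D : nat -> T -> R) (eps : R) (m k : nat) :
  (forall k, <<s G k >> `<=` <<s G k.+1 >>) ->
  (forall k, adapted (G k.+1) (D k)) ->
  adapted (G (m + k)%N) (stopped_sum D eps m k).
Proof.
move=> GS aD; elim: k => [|k IH] /=; first exact: bmeas_cst.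
rewrite addnS; have IH' := adapted_sub (GS _) IH.
apply: bmeasD => //; apply: bmeasM; first exact: indic_ball_bmeas.
exact: aD.
Qed.

(** In the square of one increment the cross term has an adapted multiplier and integrates to 0; the
    freezing indicator only shrinks the remaining square. *)
Lemma stopped_sum_sqr_le (disp : measure_display) (T : measurableType disp)
    (R : realType) (P : probability T R) (G : nat -> set (set T))
    (D : nat -> T -> R) (eps : R) (m k : nat) :
  (forall k, <<s G k >> `<=` measurable) ->
  (forall k, <<s G k >> `<=` <<s G k.+1 >>) ->
  (forall k, adapted (G k.+1) (D k)) ->
  (forall k Z, adapted (G k) Z -> \int[P]_w (Z w * D k w) = 0) ->
  \int[P]_w (stopped_sum D eps m k w ^+ 2) <=
  \sum_(i < k) \int[P]_w (D (m + i)%N w ^+ 2).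
Proof.
move=> GT GS aD orth; elim: k => [|k IH].
  rewrite big_ord0 (_ : \int[P]_w _ = 0) //.
  under eq_Rintegral do rewrite /= expr0n /=.
  by rewrite Rintegral_cst // mul0r.
have aS := @stopped_sum_adapted _ T R G D eps m k GS aD.
have bS : bmeas (stopped_sum D eps m k) := adapted_bmeas (GT _) aS.
have aI : adapted (G (m + k)%N)
    (fun w => \1_[set z | `|z| < eps] (stopped_sum D eps m k w) : R).
  exact: indic_ball_bmeas.
have bI := adapted_bmeas (GT _) aI.
have bD : bmeas (D (m + k)%N) := adapted_bmeas (GT _) (aD _).
pose X w := stopped_sum D eps m k w ^+ 2.
pose Y w := (2 * stopped_sum D eps m k w *
  \1_[set z | `|z| < eps] (stopped_sum D eps m k w)) * D (m + k)%N w.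
pose V w := \1_[set z | `|z| < eps] (stopped_sum D eps m k w) * D (m + k)%N w ^+ 2.
have bX : bmeas X by exact: bmeasM.
have bD2 : bmeas (fun w => D (m + k)%N w ^+ 2) by exact: bmeasM.
have bV : bmeas V by exact: bmeasM.
have aY : adapted (G (m + k)%N) (fun w => 2 * stopped_sum D eps m k w *
    \1_[set z | `|z| < eps] (stopped_sum D eps m k w)).
  by apply: bmeasM => //; apply: bmeasM => //; exact: bmeas_cst.
have bY : bmeas Y by apply: bmeasM => //; exact: adapted_bmeas aY.
have -> : \int[P]_w (stopped_sum D eps m k.+1 w ^+ 2) =
    \int[P]_w (X w + (Y w + V w)).
  apply: eq_Rintegral => w _; rewrite /X /Y /V /= indicE.
  by case: (_ \in _) => /=; ring.
have iX := bmeas_integrable P bX; have iY := bmeas_integrable P bY.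
have iV := bmeas_integrable P bV.
rewrite RintegralD //; last exact: (bmeas_integrable P (bmeasD bY bV)).
rewrite RintegralD // big_ord_recr /=.
rewrite (orth _ _ aY) add0r lerD //.
apply: le_Rintegral => //; first exact: bmeas_integrable.
move=> w _; rewrite /V indicE -[leRHS]mul1r ler_wpM2r ?sqr_ge0 //.
by rewrite lern1 leq_b1.
Qed.

(** Chebyshev's inequality for the stopped sum. Freezing makes the exceptional events [B k]
    increase, so their union obeys the same bound by continuity from below. *)
Lemma maximal_inequality (disp : measure_display) (T : measurableType disp)
    (R : realType) (P : probability T R) (G : nat -> set (set T))
    (D : nat -> T -> R) (eps v : R) (m : nat) :
  (forall k, <<s G k >> `<=` measurable) ->
  (forall k, <<s G k >> `<=` <<s G k.+1 >>) ->
  (forall k, adapted (G k.+1) (D k)) ->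
  (forall k Z, adapted (G k) Z -> \int[P]_w (Z w * D k w) = 0) ->
  0 < eps ->
  (forall k, \sum_(i < k) \int[P]_w (D (m + i)%N w ^+ 2) <= v) ->
  exists2 A, measurable A /\ (P A <= (v / eps ^+ 2)%:E)%E &
    forall w, ~ A w -> forall k, `|\sum_(i < k) D (m + i)%N w| < eps.
Proof.
move=> GT GS aD orth eps0 vD.
pose B k := [set w | eps <= `|stopped_sum D eps m k w|].
have bS k : bmeas (stopped_sum D eps m k).
  by apply: adapted_bmeas (GT (m + k)%N) _; exact: stopped_sum_adapted.
have mB k : measurable (B k).
  rewrite (_ : B k = (Num.norm \o stopped_sum D eps m k) @^-1` `[eps, +oo[%classic).
    apply: measurable_preimageT; last exact: measurable_itv.
    by apply: measurableT_comp; [exact: normr_measurable|exact: (bS k).1].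
  by apply/seteqP; split => w; rewrite /B /= in_itv /= andbT.
have PB k : (P (B k) <= (v / eps ^+ 2)%:E)%E.
  have PBfin : P (B k) \is a fin_num by exact: fin_num_measure.
  rewrite -(fineK PBfin) lee_fin ler_pdivlMr ?exprn_gt0 //.
  apply: le_trans (vD k).
  apply: le_trans (@stopped_sum_sqr_le _ T R P G D eps m k GT GS aD orth).
  have bB := @bmeas_indic _ T R _ (mB k).
  have <- : \int[P]_w (\1_(B k) w) = fine (P (B k)).
    by congr fine; rewrite integral_indic // setIT.
  rewrite -RintegralZr //; last exact: bmeas_integrable.
  apply: le_Rintegral => //.
  - by apply: bmeas_integrable; apply: bmeasM => //; exact: bmeas_cst.
  - by apply: bmeas_integrable; exact: bmeasM.
  - move=> w _; rewrite indicE; have [wB|_] := boolP (w \in B k).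
      rewrite mul1r -[leRHS]real_normK ?num_real //.
      by rewrite ler_pXn2r ?nnegrE ?(ltW eps0) //; exact: set_mem.
    by rewrite mul0r sqr_ge0.
have Bhomo : {homo B : a b / (a <= b)%N >-> (a <= b)%O}.
  apply: homo_leq => [A|A B' C|k]; [exact: lexx|exact: le_trans|].
  apply/subsetPset => w; rewrite /B /= indicE => wB.
  by rewrite memNset ?mul0r ?addr0 //= ltNge wB.
have mU : measurable (\bigcup_k B k) by exact: bigcup_measurable.
exists (\bigcup_k B k).
  split => //; have cP := @nondecreasing_cvg_mu _ _ _ P _ mB mU Bhomo.
  rewrite -(cvg_lim _ cP) //; apply: lime_le; first by apply/cvg_ex; eexists; exact: cP.
  by apply: nearW => k; exact: PB.
move=> w Bw k.
have [|_ H] := @stopped_sum_small _ _ D eps m k w; last exact: H.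
by rewrite ltNge; apply/negP => h; apply: Bw; exists k.
Qed.

Lemma big_nat_shift (R : realType) (u : nat -> R) (m k : nat) :
  \sum_(m <= i < k + m) u i = \sum_(i < k) u (m + i)%N.
Proof.
rewrite -{1}[m]add0n big_addn addnK big_mkord.
by apply: eq_bigr => i _; rewrite addnC.
Qed.

(** Partial sums are almost surely Cauchy: for each threshold, the maximal inequality applied from
    index [m] bounds the bad event by a tail of the convergent variance series. *)
Lemma martingale_difference_series_cvg (disp : measure_display)
    (T : measurableType disp) (R : realType) (P : probability T R)
    (G : nat -> set (set T)) (D : nat -> T -> R) :
  (forall k, <<s G k >> `<=` measurable) ->
  (forall k, <<s G k >> `<=` <<s G k.+1 >>) ->
  (forall k, adapted (G k.+1) (D k)) ->
  (forall k Z, adapted (G k) Z -> \int[P]_w (Z w * D k w) = 0) ->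
  cvgn (series (fun k => \int[P]_w (D k w ^+ 2))) ->
  {ae P, forall w, cvgn (series (fun k => D k w))}.
Proof.
move=> GT GS aD orth cD.
pose d k := \int[P]_w (D k w ^+ 2).
have d0 k : 0 <= d k by apply: Rintegral_ge0 => w _; exact: sqr_ge0.
have dnd : nondecreasing_seq (series d).
  by apply/nondecreasing_seqP => k; rewrite seriesSr lerDl.
pose l := limn (series d).
have tail m k : \sum_(i < k) d (m + i)%N <= l - series d m.
  rewrite lerBrDl (_ : _ + _ = series d (k + m)%N).
    exact: nondecreasing_cvgn_le.
  by rewrite series_addn big_nat_shift.
have osc p : {ae P, forall w, exists m,
    forall k, `|\sum_(i < k) D (m + i)%N w| < p.+1%:R^-1}.
  have p0 : 0 < p.+1%:R^-1 :> R by rewrite invr_gt0.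
  have /choice[A HA] m : exists A, (measurable A /\
      (P A <= ((l - series d m) / p.+1%:R^-1 ^+ 2)%:E)%E) /\
      forall w, ~ A w -> forall k, `|\sum_(i < k) D (m + i)%N w| < p.+1%:R^-1.
    have [A ? ?] := maximal_inequality GT GS aD orth p0 (tail m).
    by exists A.
  (* Failing for every starting index means lying in all [A m], whose probabilities have infimum
     0. *)
  pose N := \bigcap_m A m.
  have mN : measurable N by apply: bigcap_measurable => // m _; have [[]] := HA m.
  exists N; split => //.
  - apply/eqP; rewrite eq_le measure_ge0 andbT; apply/lee_addgt0Pr => e e0.
    rewrite add0e.
    have [m _ Hm] : \forall m \near \oo, l - e * p.+1%:R^-1 ^+ 2 < series d m.
      apply: (@cvgr_gt _ _ \oo _ (series d) l) => //.
      by rewrite gtrBl mulr_gt0 // exprn_gt0.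
    have [[mA PA] _] := HA m.
    apply: (@le_trans _ _ (P (A m))).
      by apply: le_measure; rewrite ?inE //; exact: bigcap_inf.
    apply: le_trans PA _; rewrite lee_fin ler_pdivrMr ?exprn_gt0 //.
    by rewrite lerBlDl -lerBlDr; apply: ltW; exact: Hm (leqnn m).
  - move=> w /= nw m _; apply: contrapT => Aw; apply: nw; exists m.
    by have [_] := HA m; apply.
have := ae_foralln osc; apply: filterS => w Hw.
apply: cauchy_cvg; apply/cauchyP => e e0.
have [p _ Hp] : \forall p \near \oo, p.+1%:R^-1 < e.
  apply: (@cvgr_lt _ _ \oo _ (fun k => k.+1%:R^-1 : R) 0) => //.
  exact: cvg_harmonic.
have [m Hm] := Hw p; exists (series (fun k => D k w) m).
exists m => // k /= mk; rewrite /ball /= -(subnK mk) series_addn opprD addNKr normrN.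
by rewrite big_nat_shift (lt_trans (Hm _)) //; exact: Hp p (leqnn p).
Qed.

(** * Random quantization *)

Lemma grid_ptS (R : realType) (lo hi : R) (B t : nat) :
  grid_pt lo hi B t.+1 = grid_pt lo hi B t + grid_step lo hi B.
Proof. by rewrite /grid_pt -natr1 mulrDl mul1r addrA. Qed.

Lemma grid_step_gt0 (R : realType) (lo hi : R) (B : nat) :
  (1 < B)%N -> lo < hi -> 0 < grid_step lo hi B.
Proof. by case: B => [|[|B]] // _ h; rewrite divr_gt0 ?subr_gt0. Qed.

Lemma grid_pt_last (R : realType) (lo hi : R) (B : nat) :
  (1 < B)%N -> grid_pt lo hi B B.-1 = hi.
Proof.
case: B => [|[|B]] // _; rewrite /grid_pt /grid_step /=.
by field; rewrite ?pnatr_eq0 //= natr1 pnatr_eq0.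
Qed.

Lemma grid_pt_inj (R : realType) (lo hi : R) (B : nat) :
  (1 < B)%N -> lo < hi -> injective (grid_pt lo hi B).
Proof.
move=> hB lohi s t /addrI /mulIf; have := grid_step_gt0 hB lohi.
by move=> /gt_eqF -> /(_ isT) /eqP; rewrite eqr_nat => /eqP.
Qed.

(** The first [n] half-open cells tile the interval from [lo] to the [n]-th grid point, so at most
    one contains [x]. *)
Lemma sum_cells (R : realType) (lo hi : R) (B n : nat) (x : R) :
  (1 < B)%N -> lo < hi -> lo <= x ->
  \sum_(t < n | grid_pt lo hi B t <= x < grid_pt lo hi B t.+1) (1 : R) =
  ((x < grid_pt lo hi B n)%R : nat)%:R.
Proof.
move=> hB lohi lox; elim: n => [|n IH].
  by rewrite big_ord0 /grid_pt mul0r addr0 ltNge lox.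
rewrite big_mkcond big_ord_recr /= -big_mkcond /= IH grid_ptS.
rewrite [in X in X + _]ltNge; case: (boolP (grid_pt lo hi B n <= x)) => /= [h|].
  by rewrite mulr0n add0r; case: (x < _).
by rewrite -ltNge addr0 => h; rewrite (lt_trans h) // ltrDl grid_step_gt0.
Qed.

Lemma sum_grid_indic (R : realType) (lo hi : R) (B t : nat) :
  (1 < B)%N -> lo < hi -> (t < B)%N ->
  \sum_(s < B) grid_pt lo hi B s * \1_[set grid_pt lo hi B s] (grid_pt lo hi B t) =
  grid_pt lo hi B t.
Proof.
move=> hB lohi tB; rewrite (bigD1 (Ordinal tB)) //= indicE mem_set // mulr1.
rewrite big1 ?addr0 // => s /eqP st; rewrite indicE memNset ?mulr0 //= => h.
by apply: st; apply: val_inj; apply: (grid_pt_inj hB lohi).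
Qed.

(** Within its cell [x] is the barycentre [(1 - p) * tau t + p * tau t.+1]. The endpoint [hi] lies
    in no cell and is supplied by the separate term of the law. *)
Lemma quant_law_mean (R : realType) (lo hi : R) (B : nat) (x : R) :
  (1 < B)%N -> lo < hi -> lo <= x <= hi ->
  \sum_(s < B) grid_pt lo hi B s * quant_law lo hi B x [set grid_pt lo hi B s] = x.
Proof.
move=> hB lohi /andP[lox xhi]; rewrite /quant_law.
have st0 := grid_step_gt0 hB lohi.
have tB t : (t < B.-1)%N -> (t < B)%N /\ (t.+1 < B)%N.
  by case: B hB {st0} => // B _ /= h; split => //; apply: ltnW.
under eq_bigr do rewrite mulrDr mulr_sumr.
rewrite big_split /= exchange_big /=.
rewrite (eq_bigr (fun=> x * 1)) => [|t _]; last first.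
  have [h1 h2] := tB _ (ltn_ord t).
  set p := (x - _) / _.
  transitivity ((1 - p) * (\sum_(s < B) grid_pt lo hi B s *
      \1_[set grid_pt lo hi B s] (grid_pt lo hi B t)) +
    p * (\sum_(s < B) grid_pt lo hi B s *
      \1_[set grid_pt lo hi B s] (grid_pt lo hi B t.+1))).
    rewrite !mulr_sumr -big_split /=; apply: eq_bigr => s _; ring.
  rewrite !sum_grid_indic // grid_ptS /p; field; by rewrite gt_eqF.
rewrite -mulr_sumr sum_cells // grid_pt_last //.
have -> : \sum_(s < B) grid_pt lo hi B s *
    (if x == hi then \1_[set grid_pt lo hi B s] hi else 0) =
    if x == hi then hi else 0.
  case: eqP => _; last by rewrite big1 // => s _; rewrite mulr0.
  rewrite -{3 4}(grid_pt_last lo hi hB) sum_grid_indic //.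
  by rewrite prednK // ltnW.
case: eqP => [->|/eqP xh]; first by rewrite ltxx mulr0 add0r.
by rewrite lt_neqAle xh xhi mulr1 addr0.
Qed.

Definition grid (R : realType) (lo hi : R) (B : nat) : set R :=
  [set y | exists2 s, (s < B)%N & y = grid_pt lo hi B s].

Lemma quant_law_grid (R : realType) (lo hi : R) (B : nat) (x : R) :
  (1 < B)%N -> quant_law lo hi B x (~` grid lo hi B) = 0.
Proof.
move=> hB; rewrite /quant_law.
have out s : (s < B)%N -> \1_(~` grid lo hi B) (grid_pt lo hi B s) = 0 :> R.
  by move=> sB; rewrite indicE memNset // => -[]; exists s.
rewrite big1 => [|t _].
  case: eqP => _; rewrite add0r //.
  by have := out B.-1; rewrite grid_pt_last //; apply; rewrite prednK // ltnW.
have tB : (t.+1 < B)%N by have := ltn_ord t; rewrite -ltnS prednK // ltnW.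
by rewrite !out ?mulr0 ?addr0 // ltnW.
Qed.

Lemma grid_sub_itv (R : realType) (lo hi : R) (B : nat) (y : R) :
  (1 < B)%N -> lo < hi -> grid lo hi B y -> lo <= y <= hi.
Proof.
move=> hB lohi [s sB ->]; have st0 := ltW (grid_step_gt0 hB lohi).
apply/andP; split; first by rewrite /grid_pt lerDl mulr_ge0.
rewrite -[leRHS](grid_pt_last lo hi hB) /grid_pt lerD2l.
by rewrite ler_wpM2r // ler_nat; case: (B) hB sB.
Qed.

(** A crude bound, cell by cell, which suffices to place the conditional probabilities in
    [bmeas]. *)
Lemma quant_law_bounded (R : realType) (lo hi : R) (B : nat) (x : R) (S : set R) :
  (1 < B)%N -> lo < hi -> `|quant_law lo hi B x S| <= B.-1%:R * 2 + 1.
Proof.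
move=> hB lohi; rewrite /quant_law; have st0 := grid_step_gt0 hB lohi.
have i1 y : 0 <= (\1_S y : R) <= 1 by rewrite indicE ler0n lern1 leq_b1.
apply: le_trans (ler_normD _ _) _; apply: lerD; last first.
  by case: eqP => _; rewrite ?normr0 //; have := i1 hi => /andP[? ?]; rewrite ger0_norm.
rewrite big_mkcond /= mulr_natl -[X in _ *+ X]card_ord -sumr_const.
apply: le_trans (ler_norm_sum _ _ _) _; apply: ler_sum => t _.
case: ifPn => [/andP[h1 h2]|_]; last by rewrite normr0.
set p := (x - _) / _.
have p0 : 0 <= p by rewrite divr_ge0 ?subr_ge0 // ltW.
have p1 : p <= 1 by rewrite ler_pdivrMr // mul1r lerBlDl -grid_ptS ltW.
have /andP[a0 a1] := i1 (grid_pt lo hi B t).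
have /andP[b0 b1] := i1 (grid_pt lo hi B t.+1).
move: a0 a1 b0 b1; set u := \1_S _; set v := \1_S _ => a0 a1 b0 b1.
rewrite ger0_norm; first nra.
by apply: addr_ge0; apply: mulr_ge0; rewrite ?subr_ge0.
Qed.

(** Naming the generators of [history] lets it be used as the sigma-algebra of a
    [g_sigma_algebraType]. *)
Definition hist_gen (R : realType) (T : Type) (n d : nat)
    (x q : nat -> 'I_n -> T -> 'rV[R]_d) (k : nat) : set (set T) :=
  [set A | exists s i m (S : set R), measurable S /\
    (((s <= k)%N /\ A = [set w | S (x s i w 0 m)]) \/
     ((s < k)%N /\ A = [set w | S (q s i w 0 m)]))].

Lemma historyE (R : realType) (T : Type) (n d : nat)
    (x q : nat -> 'I_n -> T -> 'rV[R]_d) (k : nat) :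
  history x q k = <<s hist_gen x q k >>.
Proof. by []. Qed.

Lemma history_measurable (R : realType) (disp : measure_display)
    (T : measurableType disp) (n d : nat) (x q : nat -> 'I_n -> T -> 'rV[R]_d) k :
  (forall k i, rand_vec (x k i)) -> (forall k i, rand_vec (q k i)) ->
  <<s hist_gen x q k >> `<=` measurable.
Proof.
move=> hx hq; apply: smallest_sub; first exact: sigma_algebra_measurable.
move=> _ [s [i [m [S [mS [[_ ->]|[_ ->]]]]]]].
  exact: (measurable_preimageT (hx s i m) mS).
exact: (measurable_preimageT (hq s i m) mS).
Qed.

Lemma history_mono (R : realType) (T : Type) (n d : nat)
    (x q : nat -> 'I_n -> T -> 'rV[R]_d) k :
  <<s hist_gen x q k >> `<=` <<s hist_gen x q k.+1 >>.
Proof.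
apply: sub_sigma_algebra2 => A [s [i [m [S [mS H]]]]].
exists s, i, m, S; split => //.
by case: H => -[sk ->]; [left|right]; split => //; exact: leqW.
Qed.

Lemma history_x_measurable (R : realType) (disp : measure_display)
    (T : measurableType disp) (n d : nat) (x q : nat -> 'I_n -> T -> 'rV[R]_d) k i m :
  measurable_fun [set: g_sigma_algebraType (hist_gen x q k)]
    (fun w : T => x k i w 0 m).
Proof.
move=> _ S mS; rewrite setTI; apply: sub_sigma_algebra.
by exists k, i, m, S; split => //; left.
Qed.

Lemma history_q_measurable (R : realType) (disp : measure_display)
    (T : measurableType disp) (n d : nat) (x q : nat -> 'I_n -> T -> 'rV[R]_d) k i m :
  measurable_fun [set: g_sigma_algebraType (hist_gen x q k.+1)]
    (fun w : T => q k i w 0 m).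
Proof.
move=> _ S mS; rewrite setTI; apply: sub_sigma_algebra.
by exists k, i, m, S; split => //; right.
Qed.

(* [y] itself when [y] is a grid point; bounded everywhere, unlike [q]. *)
Definition grid_part (R : realType) (lo hi : R) (B : nat) (y : R) : R :=
  \sum_(s < B) grid_pt lo hi B s * \1_[set grid_pt lo hi B s] y.

Lemma grid_part_bmeas (R : realType) (disp : measure_display)
    (T : measurableType disp) (lo hi : R) (B : nat) (Z : T -> R) :
  measurable_fun [set: T] Z -> bmeas (fun w => grid_part lo hi B (Z w)).
Proof.
move=> mZ; apply: bmeas_sum => s; apply: bmeasM; first exact: bmeas_cst.
apply: (bmeas_sub mZ); apply: bmeas_indic; exact: measurable_set1.
Qed.

Lemma grid_part_bounded (R : realType) (lo hi : R) (B : nat) (y : R) :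
  `|grid_part lo hi B y| <= \sum_(s < B) `|grid_pt lo hi B s|.
Proof.
apply: le_trans (ler_norm_sum _ _ _) _; apply: ler_sum => s _.
by rewrite normrM ler_piMr // indicE ger0_norm // lern1 leq_b1.
Qed.

Lemma Rintegral_indicM (R : realType) (disp : measure_display)
    (T : measurableType disp) (P : probability T R) (A : set T) (Y : T -> R) :
  \int[P]_w (\1_A w * Y w) = \int[P]_(w in A) Y w.
Proof.
rewrite [RHS]Rintegral_mkcond; apply: eq_Rintegral => w _.
by rewrite patchE indicE; case: (w \in A); rewrite ?mul1r ?mul0r.
Qed.

(** Both terms are combinations over grid points, by [quant_law_mean] for [x]. For each atom, the
    defining property of conditional probability on [A] cancels the two integrals. *)
Lemma quantization_unbiased (R : realType) (disp : measure_display)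
    (T : measurableType disp) (P : probability T R) (n d B : nat)
    (lo hi : 'rV[R]_d) (x q : nat -> 'I_n -> T -> 'rV[R]_d) k j m A :
  (1 < B)%N -> (forall m, lo 0 m < hi 0 m) ->
  (forall k i, rand_vec (x k i)) -> (forall k i, rand_vec (q k i)) ->
  (forall k i w, box lo hi (x k i w)) ->
  random_quantization P lo hi B x q -> <<s hist_gen x q k >> A ->
  \int[P]_w (\1_A w *
    (grid_part (lo 0 m) (hi 0 m) B (q k j w 0 m) - x k j w 0 m)) = 0.
Proof.
move=> hB lohi hx hq xX hquant GA.
have HT := history_measurable hx hq (k := k).
have mA := HT _ GA.
pose tau s := grid_pt (lo 0 m) (hi 0 m) B s.
pose Y s w := quant_law (lo 0 m) (hi 0 m) B (x k j w 0 m) [set tau s].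
pose I s w : R := \1_[set tau s] (q k j w 0 m).
have cp s := hquant k j m [set tau s] (measurable_set1 _).
have bA : bmeas (\1_A : T -> R) by exact: bmeas_indic.
have bY s : bmeas (Y s).
  split; last by exists (B.-1%:R * 2 + 1) => w; exact: quant_law_bounded.
  by move=> _ S mS; rewrite setTI; apply: HT; have [+ _ _] := cp s; apply.
have bI s : bmeas (I s).
  by apply: (bmeas_sub (hq k j m)); apply: bmeas_indic; exact: measurable_set1.
have bAI s : bmeas (fun w => \1_A w * I s w) by exact: bmeasM.
have bAY s : bmeas (fun w => \1_A w * Y s w) by exact: bmeasM.
transitivity (\int[P]_w \sum_(s < B) (tau s * (\1_A w * I s w - \1_A w * Y s w))).
  apply: eq_Rintegral => w _.
  rewrite -{1}(quant_law_mean hB (lohi m) (xX k j w m)) /grid_part -sumrB mulr_sumr.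
  by apply: eq_bigr => s _; rewrite /I /Y /tau; ring.
rewrite Rintegral_sum => [|s]; last first.
  by apply: bmeasM; [exact: bmeas_cst|exact: bmeasB].
rewrite big1 // => s _.
rewrite RintegralZl //; last by apply: bmeas_integrable; exact: bmeasB.
rewrite RintegralB //; try exact: bmeas_integrable.
rewrite Rintegral_indicM Rintegral_indicM.
have -> : \int[P]_(w in A) I s w = fine (P (A `&` [set w | [set tau s] (q k j w 0 m)])).
  have mI : measurable [set w | [set tau s] (q k j w 0 m)].
    exact: (measurable_preimageT (hq k j m) (measurable_set1 _)).
  rewrite setIC -integral_indic //; congr fine; exact: eq_integral.
have [_ _ /(_ A GA) <-] := cp s.
by rewrite /Rintegral subrr mulr0.
Qed.

(** Unbiasedness extends from history events to adapted multipliers, giving martingale differences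
    with second moments at most [(C * K) ^+ 2 * beta k ^+ 2]. *)
Lemma quantization_noise_cvg (R : realType) (disp : measure_display)
    (T : measurableType disp) (P : probability T R) (n d B : nat)
    (lo hi : 'rV[R]_d) (x q : nat -> 'I_n -> T -> 'rV[R]_d) (beta : nat -> R)
    (H : nat -> T -> R) (C : R) j m :
  (1 < B)%N -> (forall m, lo 0 m < hi 0 m) ->
  (forall k i, rand_vec (x k i)) -> (forall k i, rand_vec (q k i)) ->
  (forall k i w, box lo hi (x k i w)) ->
  random_quantization P lo hi B x q ->
  cvgn (series (fun k => beta k ^+ 2)) ->
  (forall k, adapted (hist_gen x q k) (H k)) -> (forall k w, `|H k w| <= C) ->
  {ae P, forall w, cvgn (series (fun k => beta k * H k w *
    (grid_part (lo 0 m) (hi 0 m) B (q k j w 0 m) - x k j w 0 m)))}.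
Proof.
move=> hB lohi hx hq xX hquant b2 aH HC.
pose e k w := grid_part (lo 0 m) (hi 0 m) B (q k j w 0 m) - x k j w 0 m.
pose K := \sum_(s < B) `|grid_pt (lo 0 m) (hi 0 m) B s| + (`|lo 0 m| + `|hi 0 m|).
have xb k i w l : `|x k i w 0 l| <= `|lo 0 l| + `|hi 0 l|.
  have := xX k i w l => /andP[h1 h2].
  have := ler_norm (hi 0 l); have := ler_norm (- lo 0 l); rewrite normrN => h3 h4.
  have := normr_ge0 (lo 0 l); have := normr_ge0 (hi 0 l).
  by rewrite ler_norml; lra.
have eK k w : `|e k w| <= K.
  apply: le_trans (ler_normB _ _) _; apply: lerD; first exact: grid_part_bounded.
  exact: xb.
have GT k := history_measurable hx hq (k := k).
have GS k := history_mono (x := x) (q := q) (k := k).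
have ax k : adapted (hist_gen x q k) (fun w => x k j w 0 m).
  split; first exact: history_x_measurable.
  by exists (`|lo 0 m| + `|hi 0 m|) => w; exact: xb.
have ae' k : adapted (hist_gen x q k.+1) (e k).
  apply: bmeasB; last exact: adapted_sub (GS k) (ax k).
  apply: grid_part_bmeas; exact: history_q_measurable.
have be k : bmeas (e k) := adapted_bmeas (GT k.+1) (ae' k).
have aD k : adapted (hist_gen x q k.+1) (fun w => beta k * H k w * e k w).
  apply: bmeasM; last exact: ae'.
  apply: bmeasM; first exact: bmeas_cst.
  exact: adapted_sub (GS k) (aH k).
apply: (martingale_difference_series_cvg GT GS aD).
  move=> k Z aZ.
  under eq_Rintegral do rewrite mulrA.
  apply: (@orthogonal_of_indic _ _ T (g_sigma_algebraType (hist_gen x q k)) R P id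
    (e k) (measurable_id_sub (GT k)) (be k) _ (fun w => Z w * (beta k * H k w))).
    by move=> A GA; exact: (@quantization_unbiased _ _ _ _ _ _ _ _ _ _ q).
  apply: bmeasM => //; apply: bmeasM; first exact: bmeas_cst.
  exact: aH.
apply: (@series_le_cvg _ _ ((C * K) ^+ 2 *: (fun k => beta k ^+ 2))).
- by move=> k; apply: Rintegral_ge0 => w _; exact: sqr_ge0.
- by move=> k; rewrite !fctE /GRing.scale /= mulr_ge0 ?sqr_ge0.
- move=> k; rewrite !fctE /GRing.scale /=.
  have bD := adapted_bmeas (GT k.+1) (aD k).
  apply: le_trans (ler_norm _) _.
  apply: (normr_Rintegral_le P (bmeasM bD bD)) => w.
  rewrite ger0_norm -?expr2 ?sqr_ge0 //.
  have -> : (beta k * H k w * e k w) ^+ 2 = (H k w * e k w) ^+ 2 * beta k ^+ 2 by ring.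
  rewrite ler_wpM2r ?sqr_ge0 // -[leLHS]real_normK ?num_real //.
  have CK0 : 0 <= C * K.
    rewrite mulr_ge0 //; first exact: le_trans (normr_ge0 _) (HC 0%N point).
    exact: le_trans (normr_ge0 _) (eK 0%N point).
  by rewrite ler_pXn2r ?nnegrE // normrM ler_pM.
- exact: is_cvg_seriesZ.
Qed.

(** The law gives the complement of the grid conditional probability 0; integrating over the whole
    space makes leaving the grid a null event. *)
Lemma quantization_on_grid (R : realType) (disp : measure_display)
    (T : measurableType disp) (P : probability T R) (n d B : nat)
    (lo hi : 'rV[R]_d) (x q : nat -> 'I_n -> T -> 'rV[R]_d) :
  (1 < B)%N -> (forall k i, rand_vec (q k i)) ->
  random_quantization P lo hi B x q ->
  {ae P, forall w, forall k j m, grid (lo 0 m) (hi 0 m) B (q k j w 0 m)}.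
Proof.
move=> hB hq hquant; apply: ae_foralln => k.
apply: filter_forall => j; apply: filter_forall => m.
pose S := grid (lo 0 m) (hi 0 m) B.
have mS : measurable S.
  rewrite /S (_ : grid _ _ _ = \bigcup_(s in [set s | (s < B)%N])
      [set grid_pt (lo 0 m) (hi 0 m) B s]).
    by apply: bigcup_measurable => s _; exact: measurable_set1.
  by apply/seteqP; split => y [s sB h]; exists s.
have mSC : measurable (~` S) by exact: measurableC.
exists [set w | (~` S) (q k j w 0 m)]; split => //.
  exact: (measurable_preimageT (hq k j m) mSC).
have [_ _ H] := hquant k j m _ mSC.
have hT : history x q k setT.
  rewrite historyE; exact: (@measurableT _ (g_sigma_algebraType (hist_gen x q k))).
have := H setT hT; rewrite setTI => eP; apply: etrans (esym eP) _.
by rewrite integral0_eq // => w _; rewrite quant_law_grid.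
Qed.

Lemma grid_part_id (R : realType) (lo hi : R) (B : nat) (y : R) :
  (1 < B)%N -> lo < hi -> grid lo hi B y -> grid_part lo hi B y = y.
Proof. by move=> hB lohi [s sB ->]; exact: sum_grid_indic. Qed.

(** * Almost sure noise convergence and the random limit *)

Lemma iterates_in_box (R : realType) (T : Type) (n d : nat) (lo hi : 'rV[R]_d)
    (E : rel 'I_n) (A : 'M[R]_n) (g : 'I_n -> 'rV[R]_d -> 'rV[R]_d)
    (alpha beta : nat -> R) (x q : nat -> 'I_n -> T -> 'rV[R]_d) :
  (forall i w, box lo hi (x 0%N i w)) ->
  subgradient_step (box lo hi) E A g alpha beta x q ->
  forall k i w, box lo hi (x k i w).
Proof. by move=> x0 step [|k] i w //; have [] := step k i w. Qed.

Lemma limn_sup_measurable (R : realType) (disp : measure_display)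
    (T : measurableType disp) (u : nat -> T -> R) (a b : R) :
  (forall k, measurable_fun [set: T] (u k)) -> (forall k w, a <= u k w <= b) ->
  measurable_fun [set: T] (fun w => limn_sup (u ^~ w)).
Proof.
move=> mu uab; apply: measurable_fun_limn_sup => // w _.
  by exists b => _ [k _ <-]; have /andP[] := uab k w.
by exists a => _ [k _ <-]; have /andP[] := uab k w.
Qed.

Lemma cvg_row_coord (R : realType) (d : nat) (u : nat -> 'rV[R]_d) (c : 'rV[R]_d) m :
  u k @[k --> \oo] --> c -> u k 0 m @[k --> \oo] --> c 0 m.
Proof.
move=> uc; apply/cvg_ballP => e e0; have /cvg_ballP/(_ e e0) := uc.
by apply: filterS => k [_]; apply.
Qed.

Lemma ae_noise_cvg (R : realType) (disp : measure_display)
    (T : measurableType disp) (P : probability T R) (n d B : nat)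
    (lo hi : 'rV[R]_d) (A : 'M[R]_n) (x q : nat -> 'I_n -> T -> 'rV[R]_d)
    (beta : nat -> R) :
  (1 < B)%N -> (forall m, lo 0 m < hi 0 m) ->
  (forall k i, rand_vec (x k i)) -> (forall k i, rand_vec (q k i)) ->
  (forall k i w, box lo hi (x k i w)) ->
  random_quantization P lo hi B x q ->
  cvgn (series (fun k => beta k ^+ 2)) ->
  {ae P, forall w, (forall k j, box lo hi (q k j w)) /\
    forall c, cvgn (series (fun k => beta k * noise A (x k ^~ w) (q k ^~ w) c))}.
Proof.
move=> hB lohi hx hq xX hquant b2.
have grd := quantization_on_grid hB hq hquant.
(* The multiplier 1 handles the part of the noise that is linear in [c]; the coordinates of [x k i]
   in [c2] handle the rest. *)
have c1 j m : {ae P, forall w, cvgn (series (fun k => beta k * 1 *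
    (grid_part (lo 0 m) (hi 0 m) B (q k j w 0 m) - x k j w 0 m)))}.
  apply: (@quantization_noise_cvg _ _ _ P _ _ B lo hi x q beta
    (fun _ _ => 1) 1 j m) => //.
    by move=> k; exact: bmeas_cst.
  by move=> k w; rewrite normr1.
have c2 i j m : {ae P, forall w, cvgn (series (fun k => beta k * x k i w 0 m *
    (grid_part (lo 0 m) (hi 0 m) B (q k j w 0 m) - x k j w 0 m)))}.
  have xb k w : `|x k i w 0 m| <= `|lo 0 m| + `|hi 0 m|.
    have := xX k i w m => /andP[h1 h2].
    have := ler_norm (hi 0 m); have := ler_norm (- lo 0 m); rewrite normrN => h3 h4.
    have := normr_ge0 (lo 0 m); have := normr_ge0 (hi 0 m).
    by rewrite ler_norml; lra.
  apply: (@quantization_noise_cvg _ _ _ P _ _ B lo hi x q beta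
    (fun k w => x k i w 0 m) (`|lo 0 m| + `|hi 0 m|) j m) => //.
  move=> k; split; first exact: history_x_measurable.
  by exists (`|lo 0 m| + `|hi 0 m|).
have c1' : {ae P, forall w, forall j m, cvgn (series (fun k => beta k * 1 *
    (grid_part (lo 0 m) (hi 0 m) B (q k j w 0 m) - x k j w 0 m)))}.
  by apply: filter_forall => j; apply: filter_forall => m.
have c2' : {ae P, forall w, forall i j m, cvgn (series (fun k => beta k * x k i w 0 m *
    (grid_part (lo 0 m) (hi 0 m) B (q k j w 0 m) - x k j w 0 m)))}.
  by apply: filter_forall => i; apply: filter_forall => j; apply: filter_forall => m.
apply: filterS3 grd c1' c2' => w gw h1 h2; split.
  by move=> k j m; exact: grid_sub_itv (gw k j m).
have qE k j m : grid_part (lo 0 m) (hi 0 m) B (q k j w 0 m) = q k j w 0 m.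
  exact: grid_part_id (gw k j m).
apply: cvg_noise => [j m|i j m].
  by have := h1 j m; under eq_fun do rewrite mulr1 qE.
by have := h2 i j m; under eq_fun do rewrite qE.
Qed.

Theorem theorem1 (R : realType) (disp : measure_display)
    (T : measurableType disp) (P : probability T R) (n d B : nat)
    (lo hi : 'rV[R]_d)
    (f : 'I_n -> 'rV[R]_d -> R) (L : 'I_n -> R)
    (g : 'I_n -> 'rV[R]_d -> 'rV[R]_d)
    (E : rel 'I_n) (A : 'M[R]_n) (alpha beta : nat -> R)
    (x q : nat -> 'I_n -> T -> 'rV[R]_d)
    (hB : (1 < B)%N)
    (hbox : forall m, lo 0 m < hi 0 m)
    (hconvex : forall i, convex_function (box lo hi) (f i))
    (hL : forall i, 0 <= L i)
    (hlip : forall i, elipschitz_on (box lo hi) (L i) (f i))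
    (hsubgrad : forall i y, box lo hi y ->
       is_subgradient (box lo hi) (f i) y (g i y) /\ enorm (g i y) <= L i)
    (hgraph : connected_undirected E)
    (hA : weight_assumption E A)
    (hstep : stepsizes alpha beta)
    (hx : forall k i, rand_vec (x k i))
    (hq : forall k i, rand_vec (q k i))
    (hinit : forall i w, box lo hi (x 0%N i w))
    (hquant : random_quantization P lo hi B x q)
    (hiter : subgradient_step (box lo hi) E A g alpha beta x q) :
  exists xt : T -> 'rV[R]_d,
    [/\ rand_vec xt,
        {ae P, forall w,
          is_minimizer (box lo hi) (fun y => \sum_(i < n) f i y) (xt w)} &
        forall i, {ae P, forall w, x k i w @[k --> \oo] --> xt w}].
Proof.
have xX := iterates_in_box hinit hiter.
have b2 : cvgn (series (fun k => beta k ^+ 2)).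
  case: hstep => _ _ _ _ [_ _ h]; apply: summable_EFin => // k; exact: sqr_ge0.
have path : {ae P, forall w, exists2 c,
    is_minimizer (box lo hi) (fun y => \sum_i f i y) c &
    forall i, x k i w @[k --> \oo] --> c}.
  have := @ae_noise_cvg _ _ _ P _ _ B lo hi A x q beta hB hbox hx hq xX hquant b2.
  apply: filterS => w [qX cN].
  apply: (@pathwise_convergence _ _ _ lo hi f L g E A alpha beta
    (fun k => x k ^~ w) (fun k => q k ^~ w)) => //.
(* Without nodes the objective is 0 and any constant point of the box is a minimizer. *)
case: n => [|n] in f L g E A x q hconvex hL hlip hsubgrad hgraph hA hx hq hinit
    hquant hiter xX path *.
  exists (fun=> lo); split; [by move=> m; exact: measurable_cst| |by case].
  apply: aeW => w; split => [m|y _]; first by rewrite lexx ltW.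
  by rewrite !big_ord0.
(* The upper limit along one node is defined and measurable on the whole space, and equals the
   common limit wherever the iterates converge. *)
pose xt w : 'rV[R]_d := \row_m limn_sup (fun k => x k ord0 w 0 m).
have xtE w c : x k ord0 w @[k --> \oo] --> c -> xt w = c.
  move=> xc; apply/rowP => m; rewrite mxE.
  have cm := cvg_row_coord (m := m) xc.
  by rewrite cvg_limn_supE; [exact: cvg_lim cm|apply/cvg_ex; exists (c 0 m)].
exists xt; split.
- move=> m; rewrite (_ : (fun w => xt w 0 m) =
      fun w => limn_sup (fun k => x k ord0 w 0 m)); last first.
    by apply/funext => w; rewrite mxE.
  apply: (@limn_sup_measurable _ _ _ (fun k w => x k ord0 w 0 m) (lo 0 m) (hi 0 m)).
    by move=> k; exact: hx.
  by move=> k w; exact: xX.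
- apply: filterS path => w [c cmin xc].
  by rewrite (xtE w c (xc ord0)).
- move=> i; apply: filterS path => w [c cmin xc].
  by rewrite (xtE w c (xc ord0)).
Qed.
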